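(* Let $H,\mathcal{N}\in C^\infty(\mathbb{R}^{2n})$ with $\mathcal{N}>0$, and consider on $\mathbb{R}^{2n}$ with coordinates $(q,p)\in\mathbb{R}^n\times\mathbb{R}^n$ and symplectic form $\Omega=\mathrm{d}q\wedge\mathrm{d}p$ the conformally Hamiltonian system $\dot q=\mathcal{N}\,\partial H/\partial p$, $\dot p=-\mathcal{N}\,\partial H/\partial q$. For $E\in\mathbb{R}$ let $K_E=\mathcal{N}(H-E)$ (the altered Hamiltonian), and let $\Psi_{h,E}:\mathbb{R}^{2n}\to\mathbb{R}^{2n}$ be a symplectic integrator with step size $h$ applied to the Hamiltonian system with Hamiltonian $K_E$, whose modified Hamiltonian is the formal power series $K_{mod}(q,p;h,E)=K_E(q,p)+hK_1(q,p;E)+h^2K_2(q,p;E)+\cdots$, with truncations $K^{(\ell)}_{mod}=K_E+hK_1+\dots+h^\ell K_\ell$. Let $\mathcal{E}(q,p;h)=H(q,p)+h\mathcal{E}_1(q,p)+h^2\mathcal{E}_2(q,p)+\cdots$ be the formal power series (modified conformal Hamiltonian) defined by $K_{mod}(q,p;h,\mathcal{E}(q,p;h))=0$, with truncations $\mathcal{E}^{(\ell)}=H+h\mathcal{E}_1+\dots+h^\ell\mathcal{E}_\ell$. Fix $\ell\in\mathbb{N}$ and define $\Phi^{(\ell)}_h(q,p)=\Psi_{h,\mathcal{E}^{(\ell)}(q,p;h)}(q,p)$. Then $$\Phi^{(\ell)}_h(q(t),p(t))=(q(t+h),p(t+h))+\mathcal{O}(h^{\ell+2})$$ for any solution $(q(t),p(t))$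 of $$\dot q=-\frac{\partial K^{(\ell)}_{mod}}{\partial E}\big(q,p;h,\mathcal{E}^{(\ell)}(q,p;h)\big)\frac{\partial\mathcal{E}^{(\ell)}}{\partial p}(q,p;h),\qquad \dot p=\frac{\partial K^{(\ell)}_{mod}}{\partial E}\big(q,p;h,\mathcal{E}^{(\ell)}(q,p;h)\big)\frac{\partial\mathcal{E}^{(\ell)}}{\partial q}(q,p;h).$$ Moreover, for sufficiently small $h$ this system is conformally Hamiltonian, with Hamiltonian $\mathcal{E}^{(\ell)}(\cdot;h)$ and conformal factor $\mathcal{N}^{(\ell)}_{mod}(q,p;h)=-\frac{\partial K^{(\ell)}_{mod}}{\partial E}\big(q,p;h,\mathcal{E}^{(\ell)}(q,p;h)\big)$.
   Context: A consistent numerical integrator for a vector field $f$ is a family of maps $\Psi_h$ with $\Psi_h(x)=x+hf(x)+\mathcal{O}(h^2)$; it is symplectic if, when applied to Hamiltonian vector fields, $\Psi_h^*\Omega=\Omega$. For a symplectic integrator applied to a Hamiltonian system with Hamiltonian $K$, the modified Hamiltonian is a formal power series $K+hK_1+h^2K_2+\cdots$ such that, for each $\ell$, solutions $x(t)$ of the Hamiltonian system with Hamiltonian given by its truncation after the $h^\ell$ term satisfy $\Psi_h(x(t))=x(t+h)+\mathcal{O}(h^{\ell+2})$. The series $\mathcal{E}$ exists as a formal power series by the implicit function theorem applied order by order (since $\partial K_E/\partial E=-\mathcal{N}\neq0$), and its truncation satisfies $K^{(\ell)}_{mod}(q,p;h,\mathcal{E}^{(\ell)}(q,p;h))=\mathcal{O}(h^{\ell+1})$.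 A vector field $X$ is conformally Hamiltonian with Hamiltonian $F$ and conformal factor $M>0$ if $\mathbf{i}_X\Omega=M\,\mathrm{d}F$, i.e. $\dot q=M\,\partial F/\partial p$, $\dot p=-M\,\partial F/\partial q$.
   Formalization: The O-terms, in the assumption on the modified Hamiltonian and in the conclusion, are uniform for bounded x and E; the K_j are smooth jointly in (q,p,E); and ''for sufficiently small h'' in the conformally Hamiltonian claim means on each ball, with the bound on h depending on the ball. *)

(* Defs.v *)
(* Phase space R^{2n} = 'rV[R]_(n + n),
   first n coordinates = q, last n coordinates = p. *)
From HB Require Import structures.
From mathcomp Require Import all_boot all_order all_algebra.
From mathcomp Require Import all_classical all_reals all_analysis.
Set Implicit Arguments. Unset Strict Implicit. Unset Printing Implicit Defensive.
Import Order.TTheory GRing.Theory Num.Theory.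
Import numFieldNormedType.Exports.
Local Open Scope ring_scope.
Local Open Scope classical_set_scope.

Section Defs.
Variable R : realType.

Fixpoint iterD (V : normedModType R) (vs : seq V) (f : V -> R) : V -> R :=
  match vs with
  | [::] => f
  | v :: vs' => 'D_v (iterD vs' f)
  end.

Definition smooth (V : normedModType R) (f : V -> R) : Prop :=
  forall vs : seq V, continuous (iterD vs f) /\
                     forall v x : V, derivable (iterD vs f) x v.

Variable n : nat.
Local Notation S := 'rV[R]_(n + n).

Definition eq_dir (i : 'I_n) : S := delta_mx 0 (lshift n i).
Definition ep_dir (i : 'I_n) : S := delta_mx 0 (rshift n i).

Definition Omega (u v : S) : R :=
  \sum_(i < n) (u 0 (lshift n i) * v 0 (rshift n i)
                - u 0 (rshift n i) * v 0 (lshift n i)).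

Definition cham_vf (M F : S -> R) (x : S) : S :=
  row_mx (\row_i (M x * 'D_(ep_dir i) F x))
         (\row_i (- (M x * 'D_(eq_dir i) F x))).

Definition ham_vf (F : S -> R) : S -> S := cham_vf (fun _ => 1) F.

Definition conf_ham_on (D : set S) (X : S -> S) (F M : S -> R) : Prop :=
  forall x, D x -> 0 < M x /\ X x = cham_vf M F x.

Definition solution_on (X : S -> S) (x : R -> S) (a b : R) : Prop :=
  forall t, a < t < b -> derivable x t 1 /\ 'D_1 x t = X (x t).

Definition symplectic_at (f : S -> S) (x : S) : Prop :=
  differentiable f x /\ forall u v, Omega ('d f x u) ('d f x v) = Omega u v.

Definition symplectic_integrator (Psi : R -> R -> S -> S) : Prop :=
  forall r, 0 < r -> exists h0, 0 < h0 /\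
    forall h E x, 0 < h < h0 -> `|E| <= r -> `|x| <= r ->
      symplectic_at (Psi h E) x.

Definition Kmod (K : nat -> S -> R -> R) (m : nat) (x : S) (h E : R) : R :=
  \sum_(j < m.+1) h ^+ j * K j x E.

Definition Etrunc (Ec : nat -> S -> R) (m : nat) (h : R) (x : S) : R :=
  \sum_(j < m.+1) h ^+ j * Ec j x.

Definition is_modified_hamiltonian (Psi : R -> R -> S -> S)
    (K : nat -> S -> R -> R) : Prop :=
  forall m r, 0 < r -> exists C h0, 0 < h0 /\
    forall h E, 0 < h < h0 -> `|E| <= r ->
    forall (x : R -> S) a b t,
      solution_on (ham_vf (fun y => Kmod K m y h E)) x a b ->
      a < t -> t + h < b -> `|x t| <= r ->
      `|Psi h E (x t) - x (t + h)| <= C * h ^+ m.+2.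

(* coefficient of h^k in the formal power series in h
     K_mod(x; h, E(x; h)) = sum_j h^j K_j(x; E_0(x) + sum_{i>=1} h^i E_i(x)),
   each K_j being expanded by its (formal) Taylor series in E around E_0(x). *)
Definition comp_coeff (K : nat -> S -> R -> R) (Ec : nat -> S -> R)
    (k : nat) (x : S) : R :=
  \sum_(j < k.+1) \sum_(r < k.+1)
    (derive1n r (K j x) (Ec 0%N x) / (r`!)%:R *
     (((\sum_(i < k.+1 | (0 < i)%N) Ec i x *: 'X^i) : {poly R}) ^+ r)`_(k - j)).

Definition dKdE (K : nat -> S -> R -> R) (Ec : nat -> S -> R) (l : nat)
    (h : R) (x : S) : R :=
  derive1 (fun E => Kmod K l x h E) (Etrunc Ec l h x).

Definition mod_vf (K : nat -> S -> R -> R) (Ec : nat -> S -> R) (l : nat)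
    (h : R) (x : S) : S :=
  row_mx (\row_i (- (dKdE K Ec l h x * 'D_(ep_dir i) (Etrunc Ec l h) x)))
         (\row_i (dKdE K Ec l h x * 'D_(eq_dir i) (Etrunc Ec l h) x)).

Definition Nmod (K : nat -> S -> R -> R) (Ec : nat -> S -> R) (l : nat)
    (h : R) (x : S) : R := - dKdE K Ec l h x.

Definition Phi (Psi : R -> R -> S -> S) (Ec : nat -> S -> R) (l : nat)
    (h : R) (x : S) : S := Psi h (Etrunc Ec l h x) x.

End Defs.

(* Main.v *)
(** The truncated field is tangent to the level sets of E^(l), so E^(l) keeps its
    initial value e along a solution x, and x is compared with the solution y of
    the Hamiltonian system of K^(l)_mod(.; h, e) with the same initial point,
    whose step is Psi_{h,e} up to O(h^(l+2)).  The two fields differ at x by the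
    symplectic gradient of g(x, h) = K^(l)_mod(x; h, E^(l)(x; h)); if this is
    O(h^(l+1)), then x - y is O(h^(l+2)) after time h.

    A Taylor expansion in E gives the value estimate g = O(h^(l+1)), but not the
    gradient.  The value estimate at the longer truncation order 2l+1 is
    O(h^(2l+2)), and interpolation between the value and the bounded second
    derivatives gives a gradient O(h^(l+1)); the long and short truncations are
    two values, s = h^(l+1) and s = 0, of one smooth function of (x, h, s), so
    their gradients also differ by O(h^(l+1)).

    Existence of y is obtained without integration, as an ultrafilter limit of
    Euler step functions, which inherits the bound
    |y(t') - y(t) - (t' - t) F(y(t))| <= C (t' - t)^2. *)
Require Import Defs.
From HB Require Import structures.
From mathcomp Require Import all_boot all_order all_algebra.
From mathcomp Require Import all_classical all_reals all_analysis.
From mathcomp Require Import ring lra zify.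
Import Order.TTheory GRing.Theory Num.Theory.
Import numFieldNormedType.Exports.
Local Open Scope ring_scope.
Local Open Scope classical_set_scope.

(** * Directional C^k calculus *)

(** Built on derivatives along fixed vectors, as [smooth] is, so that [smooth] yields every order by
    induction. Linearity in the direction is not part of the definition; it is recovered from
    continuity in [derive_dirD] and [derive_dirZ]. *)
Fixpoint Ck {R : realType} {V : normedModType R} (k : nat) (f : V -> R) : Prop :=
  match k with
  | 0 => continuous f
  | k'.+1 => [/\ continuous f, forall x v, derivable f x v
             & forall v, Ck k' ('D_v f)]
  end.

Lemma cvg_ext {T U : Type} {F : set_system T} {l : set_system U} (f g : T -> U) :
  f =1 g -> f x @[x --> F] --> l -> g x @[x --> F] --> l.
Proof. by move=> /funext ->. Qed.

Section Line.
Context {R : realType} {V W : normedModType R}.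

Lemma is_deriveP (f : V -> W) (x v : V) (l : W) :
  is_derive x v f l <->
  h^-1 *: (f (x + h *: v) - f x) @[h --> 0^'] --> l.
Proof.
have -> : (fun h : R => h^-1 *: (f (x + h *: v) - f x)) =
          (fun h => h^-1 *: ((f \o shift x) (h *: v) - f x)).
  by apply/funext => h; rewrite /= [h *: v + x]addrC.
split=> [[fd <-] //|fl]; split; first by apply/cvg_ex; exists l.
exact: cvg_lim.
Qed.

End Line.

Section MeanValue.
Context {R : realType} {V : normedModType R}.
Implicit Types (f : V -> R) (x u v : V).

Lemma Ck_continuous k f : Ck k f -> continuous f.
Proof. by case: k => [|k] // []. Qed.

Lemma is_derive_line f x u (t : R) : derivable f (x + t *: u) u ->
  is_derive t 1 (fun s : R => f (x + s *: u)) ('D_u f (x + t *: u)).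
Proof.
move=> fd.
have E : (fun h : R => h^-1 *: (((fun s : R => f (x + s *: u)) \o shift t) (h *: 1)
            - f (x + t *: u))) =
         (fun h : R => h^-1 *: ((f \o shift (x + t *: u)) (h *: u) - f (x + t *: u))).
  apply/funext => h /=; congr (_ *: (f _ - _)).
  by rewrite [h *: 1]mulr1 scalerDl addrCA.
by split; rewrite ?/derivable ?/derive /= E.
Qed.

(** The step [s] may have either sign, so the intermediate parameter is controlled by absolute value
    only. *)
Lemma MVT_line f x u (s : R) : Ck 1 f ->
  exists2 c : R, `|c| <= `|s| & f (x + s *: u) - f x = s * 'D_u f (x + c *: u).
Proof.
move=> [fc fd fdc].
pose g t := f (x + t *: u).
have gd (t : R) : is_derive t 1 g ('D_u f (x + t *: u)) by exact: is_derive_line.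
have gc : continuous g.
  move=> t; apply: differentiable_continuous; apply/derivable1_diffP.
  by have [] := gd t.
have gc' (A : set R) : {within A, continuous g} by apply: continuous_subspaceT.
have g0 : f x = g 0 by rewrite /g scale0r addr0.
have [s0|s0] := leP 0 s.
  have [c] := MVT_segment s0 (fun t _ => gd t) (gc' _).
  rewrite in_itv /= => /andP[c0 cs] Ec; exists c; first by rewrite !ger0_norm.
  by rewrite g0 Ec subr0 mulrC.
have [c] := MVT_segment (ltW s0) (fun t _ => gd t) (gc' _).
rewrite in_itv /= => /andP[c0 cs] Ec; exists c.
  by rewrite !ler0_norm ?lerN2 // ltW.
by rewrite g0 -opprB Ec sub0r mulrN opprK mulrC.
Qed.

(* difference quotients may be taken at a moving base point, because the
   derivative is continuous *)
Lemma cvg_moving_quotient f u (a : R -> V) x : Ck 1 f ->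
  a s @[s --> 0^'] --> x ->
  s^-1 *: (f (a s + s *: u) - f (a s)) @[s --> 0^'] --> 'D_u f x.
Proof.
move=> fC1 ax.
have /choice[c cP] : forall s : R, exists c : R, `|c| <= `|s| /\
    f (a s + s *: u) - f (a s) = s * 'D_u f (a s + c *: u).
  by move=> s; have [c] := MVT_line f (a s) u s fC1; exists c.
have s0 : (s : R) @[s --> 0^'] --> (0 : R) by exact: nbhs_dnbhs.
have c0 : c s @[s --> 0^'] --> (0 : R).
  apply/cvgr0Pnorm_lt => e e0; near=> s.
  have [cs _] := cP s; apply: le_lt_trans cs _.
  by near: s; exact: dnbhs0_lt.
have acx : a s + c s *: u @[s --> 0^'] --> x.
  suff : a s + c s *: u @[s --> 0^'] --> x + 0 *: u by rewrite scale0r addr0.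
  by apply: cvgD => //; exact: cvgZr_tmp.
have Dc : 'D_u f (a s + c s *: u) @[s --> 0^'] --> 'D_u f x.
  by case: fC1 => _ _ /(_ u) /= /(_ x) Dc; apply: (cvg_comp _ _ acx Dc).
apply: cvg_trans Dc; apply: near_eq_cvg; near=> s.
have [_ ->] := cP s; rewrite /GRing.scale /= mulKf //.
by near: s; exact: nbhs_dnbhs_neq.
Unshelve. all: by end_near. Qed.

End MeanValue.

(** * Linearity in the direction and chain rules *)

Section DirectionalDerivative.
Context {R : realType}.
Implicit Types V U : normedModType R.

Lemma pair_line U (a c : U) (b d s : R) :
  (a, b) + s *: (c, d) = (a + s *: c, b + s * d) :> U * R.
Proof. by []. Qed.

Lemma cvg_line V (x v : V) : x + s *: v @[s --> (0 : R)^'] --> x.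
Proof.
suff : x + s *: v @[s --> (0 : R)^'] --> x + 0 *: v by rewrite scale0r addr0.
by apply: cvgD; [exact: cvg_cst|apply: cvgZr_tmp; exact: nbhs_dnbhs].
Qed.

(** The increment along [u + v] is split at the point [x + s *: v]; its first half is a quotient
    along [u] at a moving base point. *)
Lemma derive_dirD V (f : V -> R) (u v x : V) : Ck 1 f ->
  'D_(u + v) f x = 'D_u f x + 'D_v f x.
Proof.
move=> fC1; have [_ fd _] := fC1.
apply: derive_val; apply/is_deriveP.
have -> : (fun s : R => s^-1 *: (f (x + s *: (u + v)) - f x)) = (fun s : R =>
   s^-1 *: (f (x + s *: v + s *: u) - f (x + s *: v)) + s^-1 *: (f (x + s *: v) - f x)).
  apply/funext => s; rewrite -scalerDr addrA subrK; congr (_ *: (f _ - _)).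
  by rewrite scalerDr -addrA [X in _ + X]addrC.
apply: cvgD; last by apply/is_deriveP; exact: DeriveDef.
apply: (cvg_moving_quotient _ _ (fun s => x + s *: v)) => //.
exact: cvg_line.
Qed.

(** One-variable chain rule with s -> c s, which covers c = 0 as well. *)
Lemma derive_dirZ V (f : V -> R) (v x : V) (c : R) : Ck 1 f ->
  'D_(c *: v) f x = c * 'D_v f x.
Proof.
move=> fC1; have [_ fd _] := fC1.
have fl := is_derive_line f x v 0; rewrite scale0r addr0 in fl.
pose g (s : R) := c * s : R.
have gd : is_derive (0 : R) 1 g c.
  apply/is_deriveP; apply: cvg_near_cst; near=> h.
  rewrite /g add0r mulr0 subr0 [h *: 1]mulr1 [LHS]mulrCA mulVf ?mulr1//.
  by near: h; exact: nbhs_dnbhs_neq.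
have fl0 : is_derive (g 0) 1 (fun s : R => f (x + s *: v)) ('D_v f x).
  by rewrite /g mulr0; exact: fl.
apply: derive_val; rewrite mulrC; apply/is_deriveP.
have /is_deriveP := is_derive1_comp fl0 gd.
apply: cvg_ext => h /=; rewrite /g.
by rewrite add0r mulr0 scale0r addr0 [h *: 1]mulr1 scalerA [c * h]mulrC.
Unshelve. all: by end_near. Qed.

Lemma derive_dir_sum V (I : finType) (f : V -> R) (b : I -> V) (c : I -> R) (x : V) :
  Ck 1 f -> 'D_(\sum_i c i *: b i) f x = \sum_i c i * 'D_(b i) f x.
Proof.
move=> fC; elim: (index_enum I) => [|i s IH].
  by rewrite !big_nil -(scale0r 0) derive_dirZ ?mul0r.
by rewrite !big_cons derive_dirD// derive_dirZ// IH.
Qed.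

(** The hypothesis says that [A] is affine with linear part [A']; it turns one difference quotient
    literally into the other. *)
Lemma is_derive_comp_aff V U (F : U -> R) (A A' : V -> U) (y v : V) :
  (forall (s : R) x z, A (x + s *: z) = A x + s *: A' z) ->
  derivable F (A y) (A' v) -> is_derive y v (fun y => F (A y)) ('D_(A' v) F (A y)).
Proof.
move=> Alin Fd; apply/is_deriveP; have /is_deriveP := DeriveDef Fd erefl.
by apply: cvg_ext => h; rewrite Alin.
Qed.

(** First the affine argument moves while the scalar one stays at [e (z + s *: v)], a quotient at a
    moving base point; then the scalar argument moves alone, by the one-variable chain rule. *)
Lemma is_derive_comp_pair V U (F : U * R -> R) (A A' : V -> U) (e : V -> R) (z v : V) :
  (forall (s : R) x y, A (x + s *: y) = A x + s *: A' y) ->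
  Ck 1 F -> continuous e -> derivable e z v ->
  is_derive z v (fun y => F (A y, e y))
    ('D_(A' v, 0) F (A z, e z) + 'D_(0, 1) F (A z, e z) * 'D_v e z).
Proof.
move=> Alin FC1 ec ed; have [_ Fd _] := FC1.
pose a (s : R) := (A z, e (z + s *: v)).
apply/is_deriveP.
have -> : (fun s : R => s^-1 *: (F (A (z + s *: v), e (z + s *: v)) - F (A z, e z))) =
  (fun s : R => s^-1 *: (F (a s + s *: (A' v, 0)) - F (a s)) +
           s^-1 *: (F (a s) - F (A z, e z))).
  apply/funext => s; rewrite -scalerDr addrA subrK; congr (_ *: (F _ - _)).
  by rewrite /a pair_line Alin mulr0 addr0.
have ec0 : e (z + s *: v) @[s --> 0^'] --> e z.
  by apply: (@cvg_comp _ _ _ (fun s : R => z + s *: v) e); [exact: cvg_line|exact: ec].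
apply: cvgD.
  apply: (cvg_moving_quotient F (A' v, 0) a) => //.
  have Az : A z @[s --> (0 : R)^'] --> A z by exact: cvg_cst.
  exact: (cvg_pair Az ec0).
have linE (E : R) : (A z, 0) + E *: (0, 1) = (A z, E) :> U * R.
  by rewrite pair_line scaler0 addr0 add0r mulr1.
have FE : is_derive (e (z + 0 *: v)) 1 (fun E : R => F (A z, E)) ('D_(0, 1) F (A z, e z)).
  have := is_derive_line F (A z, 0) (0, 1) (e z) (Fd _ _).
  rewrite linE scale0r addr0; congr (is_derive _ _ _ _).
  by apply/funext => E; rewrite linE.
have ev : is_derive (0 : R) 1 (fun s : R => e (z + s *: v)) ('D_v e z).
  by have := is_derive_line e z v 0; rewrite scale0r addr0; apply.
have /is_deriveP := is_derive1_comp FE ev.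
apply: cvg_ext => h /=.
by rewrite add0r scale0r addr0 [h *: 1]mulr1.
Qed.

End DirectionalDerivative.

(** * Closure properties of the C^k classes *)

Section CkClosure.
Context {R : realType}.
Implicit Types V U : normedModType R.

Lemma Ck_ext V k (f g : V -> R) : f =1 g -> Ck k f -> Ck k g.
Proof. by move=> /funext ->. Qed.

Lemma CkS V k (f : V -> R) : Ck k.+1 f ->
  [/\ continuous f, forall x v, derivable f x v & forall v, Ck k ('D_v f)].
Proof. by []. Qed.

Lemma CkW V k (f : V -> R) : Ck k.+1 f -> Ck k f.
Proof.
elim: k f => [|k IH] f [fc fd fD] //=.
by split=> // v; apply: IH; exact: fD.
Qed.

Lemma Ck_C1 V k (f : V -> R) : Ck k.+1 f -> Ck 1 f.
Proof. by elim: k => [//|k IH] /CkW. Qed.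

Lemma Ck_cst V k (c : R) : Ck k (fun _ : V => c).
Proof.
elim: k c => [|k IH] c /=; first by move=> ?; exact: cvg_cst.
split=> [?||v]; first exact: cvg_cst.
  by move=> x v; exact: derivable_cst.
rewrite (_ : 'D_v _ = fun=> 0); first exact: IH.
by apply/funext => x; rewrite derive_cst.
Qed.

Lemma Ck_add V k (f g : V -> R) : Ck k f -> Ck k g -> Ck k (fun x => f x + g x).
Proof.
elim: k f g => [|k IH] f g /=.
  by move=> fc gc x; apply: cvgD; [exact: fc|exact: gc].
move=> [fc fd fD] [gc gd gD]; split=> [x|x v|v].
- by apply: cvgD; [exact: fc|exact: gc].
- exact: derivableD.
- rewrite (_ : 'D_v _ = fun x => 'D_v f x + 'D_v g x); first by apply: IH.
  by apply/funext => x; exact: deriveD.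
Qed.

Lemma Ck_mul V k (f g : V -> R) : Ck k f -> Ck k g -> Ck k (fun x => f x * g x).
Proof.
elim: k f g => [|k IH] f g.
  by move=> fc gc x; apply: cvgM; [exact: fc|exact: gc].
move=> fC gC; have [fc fd fD] := CkS _ _ _ fC; have [gc gd gD] := CkS _ _ _ gC; split=> [x|x v|v].
- by apply: cvgM; [exact: fc|exact: gc].
- exact: derivableM.
- rewrite (_ : 'D_v _ = fun x => f x * 'D_v g x + g x * 'D_v f x); last first.
    by apply/funext => x; exact: deriveM.
  by apply: Ck_add; apply: IH; do ?[exact: CkW|exact: fD|exact: gD].
Qed.

Lemma Ck_opp V k (f : V -> R) : Ck k f -> Ck k (fun x => - f x).
Proof.
move=> fC; rewrite (_ : (fun x => _) = fun x => -1 * f x).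
  by apply: Ck_mul => //; exact: Ck_cst.
by apply/funext => x; rewrite mulN1r.
Qed.

Lemma Ck_exp V k (f : V -> R) m : Ck k f -> Ck k (fun x => f x ^+ m).
Proof.
move=> fC; elim: m => [|m IH]; first exact: Ck_cst.
by apply: Ck_ext (Ck_mul _ _ _ _ fC IH) => x; rewrite exprS.
Qed.

Lemma Ck_sum V k (I : Type) (s : seq I) (P : pred I) (f : I -> V -> R) :
  (forall i, P i -> Ck k (f i)) -> Ck k (fun x => \sum_(i <- s | P i) f i x).
Proof.
move=> fC; elim: s => [|i s IH].
  by apply: Ck_ext (Ck_cst _ _ 0) => x; rewrite big_nil.
case Pi : (P i).
  by apply: Ck_ext (Ck_add _ _ _ _ (fC _ Pi) IH) => x; rewrite big_cons Pi.
by apply: Ck_ext IH => x; rewrite big_cons Pi.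
Qed.

Lemma Ck_inv V k (f : V -> R) : (forall x, f x != 0) -> Ck k f ->
  Ck k (fun x => (f x)^-1).
Proof.
move=> f0; elim: k => [|k IH].
  by move=> fc x; apply: cvgV => //; exact: fc.
move=> fC; have [fc fd fD] := CkS _ _ _ fC; have finv := IH (CkW _ _ _ fC); split=> [x|x v|v].
- by apply: cvgV => //; exact: fc.
- exact: derivableV.
- rewrite (_ : 'D_v _ = fun x => - (((f x)^-1) ^+ 2 * 'D_v f x)); last first.
    by apply/funext => x; rewrite deriveV// /GRing.scale /= exprVn mulNr.
  by apply/Ck_opp/Ck_mul; [exact: Ck_exp|exact: fD].
Qed.

(** Serves to evaluate a family in x and E at an energy E(x). The derivative is a combination of
    composites of the same shape, one order lower, so induction on [k] closes. *)
Lemma Ck_comp_pair V U k (F : U * R -> R) (A A' : V -> U) (e : V -> R) :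
  (forall (s : R) x y, A (x + s *: y) = A x + s *: A' y) -> continuous A ->
  Ck k F -> Ck k e -> Ck k (fun y => F (A y, e y)).
Proof.
move=> Alin Ac.
have cont G (e' : V -> R) : continuous G -> continuous e' -> continuous (fun y => G (A y, e' y) : R).
  move=> Gc ec y; apply: (@cvg_comp _ _ _ (fun y => (A y, e' y)) G); last exact: Gc.
  exact: (cvg_pair (Ac y) (ec y)).
elim: k F e => [|k IH] F e; first exact: cont.
move=> FC eC; have [Fc Fd FD] := CkS _ _ _ FC; have [ec ed eD] := CkS _ _ _ eC.
have D y v := is_derive_comp_pair V U F A A' e y v Alin (Ck_C1 _ _ _ FC) ec (ed y v).
split=> [|y v|v]; first exact: cont.
  by have [] := D y v.
rewrite (_ : 'D_v _ = fun y => 'D_(A' v, 0) F (A y, e y) + 'D_(0, 1) F (A y, e y) * 'D_v e y).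
  have IHe u := IH _ e (FD u) (CkW _ _ _ eC).
  by apply: Ck_add; [exact: IHe|apply: Ck_mul; [exact: IHe|exact: eD]].
by apply/funext => y; have [_ ->] := D y v.
Qed.

Lemma Ck_comp_aff V U k (F : U -> R) (A A' : V -> U) :
  (forall (s : R) x y, A (x + s *: y) = A x + s *: A' y) -> continuous A ->
  Ck k F -> Ck k (fun y => F (A y)).
Proof.
move=> Alin Ac; elim: k F => [|k IH] F.
  by move=> Fc y; apply: (@cvg_comp _ _ _ A F); [exact: Ac|exact: Fc].
move=> [Fc Fd FD].
have D y v := is_derive_comp_aff V U F A A' y v Alin (Fd (A y) (A' v)).
split=> [y|y v|v]; first by apply: (@cvg_comp _ _ _ A F); [exact: Ac|exact: Fc].
  by have [] := D y v.
rewrite (_ : 'D_v _ = fun y => 'D_(A' v) F (A y)); first exact: (IH _ (FD (A' v))).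
by apply/funext => y; have [_ ->] := D y v.
Qed.

Lemma Ck_lin V k (A : V -> R) :
  (forall (s : R) x y, A (x + s *: y) = A x + s * A y) -> continuous A -> Ck k A.
Proof.
move=> Alin Ac.
apply: (@Ck_comp_aff V R k (fun t => t) A A) => //.
have idD (t v : R) : is_derive t v (fun t : R => t) v.
  apply/is_deriveP; apply: cvg_near_cst; near=> h.
  rewrite addrC addKr scalerA mulVf ?scale1r//.
  by near: h; exact: nbhs_dnbhs_neq.
case: k => [|k] /=; first by move=> ?.
split=> [?|x v|v]; [by []|by have [] := idD x v|].
rewrite (_ : 'D_v _ = fun=> v); first exact: Ck_cst.
by apply/funext => t0; have [_ ->] := idD t0 v.
Unshelve. all: by end_near. Qed.

Lemma smooth_Ck V (f : V -> R) : smooth f -> forall k, Ck k f.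
Proof.
move=> fs k; suff: forall vs, Ck k (Defs.iterD vs f) by move=> /(_ [::]).
elim: k => [|k IH] vs /=; first by have [] := fs vs.
by have [fc fd] := fs vs; split=> // v; exact: (IH (v :: vs)).
Qed.

End CkClosure.

(** * Finite-dimensional spaces *)

(** Collects the two consequences of finite dimension that the estimates use, coordinates bounded by
    the norm and compact balls, in a form stable under products with the line of values of h, E or
    s. *)
Definition finite_dim {R : realType} (V : normedModType R) : Prop :=
  (exists (I : finType) (b : I -> V) (c : I -> V -> R),
     (forall v, v = \sum_i c i v *: b i) /\ (forall i v, `|c i v| <= `|v|)) /\
  (forall r : R, compact [set v : V | `|v| <= r]).

Section FiniteDim.
Context {R : realType}.

Lemma mx_entry_le m n (A : 'M[R]_(m, n)) i j : `|A i j| <= `|A|.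
Proof.
rewrite [leRHS]/Num.norm /= mx_normrE; apply/bigmax_geP; right => /=.
by exists (i, j).
Qed.

Lemma mx_norm_le m n (A : 'M[R]_(m, n)) (r : R) : 0 <= r ->
  (forall i j, `|A i j| <= r) -> `|A| <= r.
Proof.
move=> r0 Ar; rewrite [leLHS]/Num.norm /= mx_normrE; by apply/bigmax_leP; split.
Qed.

Lemma closed_ball0 (V : normedModType R) (r : R) : closed [set v : V | `|v| <= r].
Proof.
have -> : [set v : V | `|v| <= r] = (fun v => `|v|) @^-1` [set x : R | x <= r] by [].
by apply: closed_comp; [move=> ? _; exact: norm_continuous|exact: closed_le].
Qed.

Lemma finite_dim_rV m : finite_dim 'rV[R]_m.
Proof.
split.
  exists 'I_m, (fun i => delta_mx 0 i), (fun i (v : 'rV_m) => v 0 i); split.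
    by move=> v; exact: row_sum_delta.
  by move=> i v; exact: mx_entry_le.
move=> r; apply: bounded_closed_compact; last exact: closed_ball0.
by exists r; split=> [|x rx v /= /le_trans]; [exact: num_real|apply; exact: ltW].
Qed.

Lemma finite_dim_R : finite_dim R.
Proof.
split.
  exists unit, (fun=> 1), (fun _ (v : R) => v); split=> // v.
  by rewrite (big_pred1 tt) ?[_ *: _]mulr1// => -[].
move=> r; have -> : [set v : R | `|v| <= r] = `[- r, r]%classic.
  by apply/seteqP; split=> x /=; rewrite in_itv /= ler_norml.
exact: segment_compact.
Qed.

Lemma finite_dim_prod (U V : normedModType R) :
  finite_dim U -> finite_dim V -> finite_dim (U * V : Type).
Proof.
move=> [[I [b [c [bc cle]]]] cU] [[J [b' [c' [bc' cle']]]] cV]; split.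
  exists (I + J)%type, (fun k => match k with inl i => (b i, 0) | inr j => (0, b' j) end),
   (fun k (v : U * V) => match k with inl i => c i v.1 | inr j => c' j v.2 end); split.
    move=> [u v]; rewrite big_sumType /=.
    rewrite {1}(bc u) {1}(bc' v).
    apply/eqP; rewrite xpair_eqE /=; apply/andP; split; apply/eqP.
      rewrite !raddf_sum /= [X in _ + X]big1 ?addr0// => j _.
      by rewrite scaler0.
    rewrite !raddf_sum /= [X in X + _]big1 ?add0r// => j _.
    by rewrite scaler0.
  move=> [i|j] v; rewrite prod_normE le_max.
    by rewrite cle.
  by rewrite cle' orbT.
move=> r; have -> : [set v : U * V | `|v| <= r] =
    [set u | `|u| <= r] `*` [set v | `|v| <= r].
  by apply/seteqP; split=> -[u v] /=; rewrite prod_normE ge_max => /andP.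
exact: compact_setX.
Qed.

End FiniteDim.

(** * Uniform bounds on balls *)

Section Bounds.
Context {R : realType} {V : normedModType R}.
Hypothesis fV : finite_dim V.

Lemma bounded_on_ball (f : V -> R) (r : R) : continuous f ->
  exists2 B, 0 <= B & forall x, `|x| <= r -> `|f x| <= B.
Proof.
move=> fc; have [_ /(_ r) cV] := fV.
have : compact (f @` [set v : V | `|v| <= r]).
  by apply: continuous_compact => //; exact: continuous_subspaceT.
move=> /compact_bounded [M [_ /(_ (`|M| + 1))]] MB.
exists (`|M| + 1); first by rewrite addr_ge0.
move=> x xr; apply: MB; last by exists x.
by rewrite (le_lt_trans (ler_norm M)) ?ltrDl.
Qed.

(** Uniformity in the direction comes from expanding [v] in the finite family and bounding the
    derivatives along its members by compactness. *)
Lemma derive_dir_bound (f : V -> R) (r : R) : Ck 1 f ->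
  exists2 B, 0 <= B & forall x v, `|x| <= r -> `|'D_v f x| <= B * `|v|.
Proof.
move=> fC; have [[I [b [c [bc cle]]]] _] := fV.
have [_ _ fD] := CkS _ _ _ fC.
have /choice[B BP] : forall i, exists B, 0 <= B /\ forall x, `|x| <= r -> `|'D_(b i) f x| <= B.
  by move=> i; have [B] := bounded_on_ball _ r (fD (b i)); exists B.
exists (\sum_i B i); first by apply: sumr_ge0 => i _; have [] := BP i.
move=> x v xr.
rewrite {1}(bc v) derive_dir_sum//.
apply: le_trans (ler_norm_sum _ _ _) _.
rewrite mulr_suml; apply: ler_sum => i _; rewrite normrM mulrC.
by apply: ler_pM => //; have [_] := BP i; apply.
Qed.

Lemma lipschitz_on_ball (f : V -> R) (r : R) : Ck 1 f ->
  exists2 L, 0 <= L & forall x y, `|x| <= r -> `|y| <= r ->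
    `|f x - f y| <= L * `|x - y|.
Proof.
(* The intermediate point is y + c (x - y) with |c| <= 1 of either sign; its norm is at most r + 2
   r. *)
move=> fC; have [L L0 LP] := derive_dir_bound _ (3 * r) fC; exists L => // x y xr yr.
have [c c1] := MVT_line f y (x - y) 1 fC.
rewrite scale1r [y + _]addrC subrK mul1r => ->; apply: LP.
rewrite normr1 in c1; apply: le_trans (ler_normD _ _) _; rewrite normrZ.
have := ler_normB x y; have : `|c| * `|x - y| <= 1 * `|x - y| by apply: ler_pM.
lra.
Qed.

(** The curve is replaced by its tangent line; local Lipschitz continuity of [f] turns the o(s)
    deviation of the curve into an o(s) change of the value. *)
Lemma is_derive_along (f : V -> R) (x : R -> V) (t : R) : Ck 1 f ->
  derivable x t 1 -> is_derive t 1 (fun s => f (x s)) ('D_('D_1 x t) f (x t)).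
Proof.
move=> fC xd; set u := 'D_1 x t.
have /is_deriveP xu : is_derive t 1 x u by exact: DeriveDef.
have fu : s^-1 *: (f (x t + s *: u) - f (x t)) @[s --> (0 : R)^'] --> 'D_u f (x t).
  by apply/is_deriveP; have [_ fd _] := CkS _ _ _ fC; exact: DeriveDef.
have [L L0 LP] := lipschitz_on_ball _ (`|x t| + 1) fC.
apply/is_deriveP; rewrite -[X in _ --> X]addr0.
pose q (s : R) : R := s^-1 *: (f (x (t + s *: 1)) - f (x t + s *: u)).
have fE : (fun s : R => s^-1 *: (f (x t + s *: u) - f (x t)) + q s) =1
          (fun s => s^-1 *: (f (x (t + s *: 1)) - f (x t))).
  by move=> s; rewrite -scalerDr [X in _ *: X]addrC addrA subrK.
apply: (cvg_ext _ _ fE); apply: cvgD => //.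
have xc : x (t + s *: 1) @[s --> (0 : R)^'] --> x t.
  apply: (@cvg_comp _ _ _ (fun s : R => t + s *: 1) x); first exact: cvg_line.
  have xd' : differentiable x t by apply/derivable1_diffP.
  exact: (differentiable_continuous xd').
apply/cvgr0Pnorm_lt => e e0; near=> s.
have s0 : s != 0 by near: s; exact: nbhs_dnbhs_neq.
have -> : `|q s| = `|s|^-1 * `|f (x (t + s *: 1)) - f (x t + s *: u)|.
  by rewrite normrZ normfV.
have b1 : `|x (t + s *: 1) - x t| < 1.
  by near: s; move: xc => /cvgrPdistC_lt; apply.
have b2 : `|x t + s *: u - x t| < 1.
  by near: s; have /cvgrPdistC_lt := cvg_line _ (x t) u; apply.
have tri (y : V) : `|y - x t| < 1 -> `|y| <= `|x t| + 1.
  by move=> yx; rewrite -[y](subrK (x t)) addrC (le_trans (ler_normD _ _))// lerD2l ltW.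
have b3 : `|s^-1 *: (x (t + s *: 1) - x t) - u| < e / (L + 1).
  by near: s; move: xu => /cvgrPdistC_lt; apply; rewrite divr_gt0// ltr_wpDl.
have -> : e = (L + 1) * (e / (L + 1)) by rewrite mulrC divfK// gt_eqF// ltr_wpDl.
apply: (@le_lt_trans _ _ (L * `|s^-1 *: (x (t + s *: 1) - x t) - u|)); last first.
  have L1 : 0 < L + 1 by rewrite ltr_wpDl.
  by apply: le_lt_trans (_ : _ <= (L + 1) * _) _;
    [apply: ler_wpM2r; rewrite ?lerDl|rewrite ltr_pM2l].
have -> : s^-1 *: (x (t + s *: 1) - x t) - u = s^-1 *: (x (t + s *: 1) - (x t + s *: u)).
  by rewrite opprD addrA [RHS]scalerBr scalerA mulVf ?scale1r.
rewrite normrZ normfV mulrCA ler_wpM2l ?invr_ge0//.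
by apply: LP; apply: tri.
Unshelve. all: by end_near. Qed.

End Bounds.

(** * Ordinary differential equations *)

Lemma fmap_ultra {T U : Type} (f : T -> U) (F : set_system T) :
  UltraFilter F -> UltraFilter (f @ F).
Proof.
move=> FU; split=> [|G GP FG]; first exact: fmap_proper_filter.
apply/seteqP; split=> // A GA.
have [//|FnA] := in_ultra_setVsetC (f @^-1` A) FU.
have GnA : G (~` A) by exact: FG.
have /filter_ex [x [? ?]] : G (A `&` ~` A) by exact: filterI.
by [].
Qed.

Lemma is_derive_quadratic {R : realType} {V : normedModType R} (y : R -> V)
    (t C : R) (l : V) :
  (\forall h \near (0 : R), `|y (t + h) - y t - h *: l| <= C * h ^+ 2) ->
  is_derive t 1 y l.
Proof.
move=> yC; apply/is_deriveP; apply/cvgrPdistC_lt => e e0; near=> h.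
have h0 : h != 0 by near: h; exact: nbhs_dnbhs_neq.
have : `|y (t + h) - y t - h *: l| <= C * h ^+ 2.
  near: h; exact: (nbhs_dnbhs yC).
rewrite [h *: 1]mulr1 => yh.
have -> : h^-1 *: (y (t + h) - y t) - l = h^-1 *: (y (t + h) - y t - h *: l).
  by rewrite [RHS]scalerBr scalerA mulVf ?scale1r.
rewrite normrZ normfV mulrC ltr_pdivrMr ?normr_gt0//.
apply: le_lt_trans yh _; rewrite -real_normK ?num_real// expr2 mulrA ltr_pM2r ?normr_gt0//.
apply: (@le_lt_trans _ _ ((`|C| + 1) * `|h|)).
  by rewrite ler_wpM2r// (le_trans (ler_norm C))// lerDl.
rewrite mulrC -ltr_pdivlMr ?ltr_wpDl//.
by near: h; apply: dnbhs0_lt; rewrite divr_gt0// ltr_wpDl.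
Unshelve. all: by end_near. Qed.

(** * Euler step functions and their ultrafilter limit *)

Section Euler.
Context {R : realType} {V : normedModType R}.
Variables (F : V -> V) (M L : R).
Hypotheses (FM : forall v, `|F v| <= M)
           (FL : forall u v, `|F u - F v| <= L * `|u - v|).
Hypothesis L0 : 0 <= L.

Let step (tau : R) (v : V) : V := v + tau *: F v.

Let M0 : 0 <= M. Proof. by apply: le_trans (FM 0). Qed.

Lemma euler_lipschitz (tau : R) p v : 0 <= tau ->
  `|iter p (step tau) v - v| <= p%:R * tau * M.
Proof.
move=> tau0; elim: p => [|p IH]; first by rewrite subrr normr0 !mul0r.
rewrite iterS {1}/step addrAC; apply: le_trans (ler_normD _ _) _.
rewrite -natr1 !mulrDl mul1r lerD// normrZ ger0_norm// ler_wpM2l//.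
Qed.

(** After p steps the field has drifted by at most L M p tau, and each further step multiplies this
    drift by tau. The bound depends on the elapsed time p tau alone, so it survives refinement of
    the step. *)
Lemma euler_quadratic (tau : R) p v : 0 <= tau ->
  `|iter p (step tau) v - v - (p%:R * tau) *: F v| <= L * M * (p%:R * tau) ^+ 2.
Proof.
move=> tau0; elim: p => [|p IH].
  by rewrite subrr mul0r scale0r subr0 normr0 expr0n mulr0.
set w := iter p (step tau) v in IH *.
have -> : iter p.+1 (step tau) v - v - (p.+1%:R * tau) *: F v =
  (w - v - (p%:R * tau) *: F v) + tau *: (F w - F v).
  rewrite iterS -/w /step -natr1 mulrDl mul1r scalerDl scalerBr opprD.
  rewrite !addrA; congr (_ - _); rewrite [RHS]addrAC; congr (_ - _).
  by rewrite addrAC.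
apply: le_trans (ler_normD _ _) _; rewrite normrZ ger0_norm//.
have h1 : tau * `|F w - F v| <= tau * (L * (p%:R * tau * M)).
  apply: ler_wpM2l => //; apply: le_trans (FL _ _) _; apply: ler_wpM2l => //.
  exact: euler_lipschitz.
apply: le_trans (lerD IH h1) _; rewrite -natr1.
have : 0 <= p%:R * tau * (L * M) * tau by rewrite !mulr_ge0.
have : 0 <= L * M * tau ^+ 2 by rewrite !mulr_ge0// sqr_ge0.
by set q := p%:R; nra.
Qed.

Variable x0 : V.

(** The Euler polygon with step 1/(k+1), frozen between nodes. [Num.trunc] returns 0 on negative
    arguments, so the value is [x0] for s <= 0. *)
Let euler (k : nat) (s : R) : V :=
  iter (Num.trunc (s / k.+1%:R^-1)) (step k.+1%:R^-1) x0.

(** Each time is rounded down by less than one step, so the two rounding errors differ by at most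
    one step. *)
Lemma euler_increment k (s s' : R) : 0 <= s -> s <= s' ->
  exists p : nat, euler k s' = iter p (step k.+1%:R^-1) (euler k s) /\
    `|p%:R * k.+1%:R^-1 - (s' - s)| <= k.+1%:R^-1 :> R.
Proof.
move=> s0 ss'; set tau := k.+1%:R^-1 : R.
have tau0 : 0 < tau by rewrite invr_gt0.
have h0 : 0 <= s / tau by rewrite divr_ge0// ltW.
have hh : s / tau <= s' / tau by rewrite ler_pM2r// invr_gt0.
have tt : (Num.trunc (s / tau) <= Num.trunc (s' / tau))%N by exact: le_truncn.
exists (Num.trunc (s' / tau) - Num.trunc (s / tau))%N; split.
  by rewrite -ssrnat.iterD subnK.
have /andP[a1 a2] := truncn_itv h0.
have /andP[b1 b2] := truncn_itv (le_trans h0 hh).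
rewrite -natr1 in a2; rewrite -natr1 in b2; rewrite natrB//.
move: a1 a2 b1 b2; set a := (Num.trunc (s / tau))%:R; set b := (Num.trunc (s' / tau))%:R.
rewrite !ler_pdivlMr// => a1; rewrite ltr_pdivrMr//. rewrite mulrDl mul1r => a2 b1.
rewrite ltr_pdivrMr// mulrDl mul1r mulrBl => b2.
rewrite ler_norml => *; apply/andP; split; lra.
Qed.

(** Along an ultrafilter finer than [\oo] the values at every time converge simultaneously, since
    each stays in a compact ball; the two-point Euler bounds are nonstrict and pass to the limit. *)
Lemma ode_forward : finite_dim V ->
  exists y : R -> V, [/\ y 0 = x0,
    forall s s', 0 <= s -> s <= s' -> `|y s' - y s| <= M * (s' - s) &
    forall s s', 0 <= s -> s <= s' ->
      `|y s' - y s - (s' - s) *: F (y s)| <= L * M * (s' - s) ^+ 2].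
Proof.
move=> [_ cV].
have [U [UU Uoo]] := @ultraFilterLemma nat \oo _.
have UP : ProperFilter U by exact: ultra_proper.
pose tau (k : nat) : R := k.+1%:R^-1.
have tau0 k : 0 < tau k by rewrite invr_gt0.
have tauU : tau k @[k --> U] --> (0 : R).
  apply: cvg_trans (@cvg_harmonic R); move=> A; exact: Uoo.
have incr k s s' : 0 <= s -> s <= s' ->
    `|euler k s' - euler k s| <= (s' - s + tau k) * M.
  move=> s0 ss'; have [p [-> ps]] := euler_increment k s s' s0 ss'.
  apply: le_trans (euler_lipschitz _ _ _ (ltW (tau0 k))) _.
  by apply: ler_wpM2r => //; move: ps; rewrite -/(tau k) ler_norml; lra.
have euler0 k s : s <= 0 -> euler k s = x0.
  move=> s0; rewrite /euler (_ : Num.trunc _ = 0%N)//.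
  apply/truncn0Pn; rewrite -ltNge (le_lt_trans _ (ltr01))//.
  by rewrite mulr_le0_ge0// invr_ge0 ltW// tau0.
have /choice[y yP] : forall s : R, exists v : V, euler k s @[k --> U] --> v.
  move=> s.
  (* The step is at most 1, so the time covered by the Euler steps is at most |s| + 1. *)
  have := cV (`|x0| + (`|s| + 1) * M); rewrite compact_ultra.
  move=> /(_ _ (fmap_ultra (fun k => euler k s) U UU)) [|v [_ ?]]; last by exists v.
  apply: (@filterS _ U _ setT) => [k _ /=|]; last exact: filterT.
  have [s0|s0] := leP s 0; first by rewrite euler0// lerDl mulr_ge0// addr_ge0.
  have := incr k 0 s (lexx _) (ltW s0); rewrite (euler0 k 0)// subr0 => h.
  rewrite -[euler k s](subrK x0) addrC (le_trans (ler_normD _ _))// lerD2l.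
  apply: le_trans h _; apply: ler_wpM2r => //; rewrite gtr0_norm// lerD2l.
  by rewrite /tau invf_le1// ler1n.
have FC : continuous F.
  move=> v; apply/cvgrPdistC_lt => e e0; near=> u.
  apply: (le_lt_trans (FL u v)).
  apply: (@le_lt_trans _ _ ((L + 1) * `|u - v|)); first by rewrite ler_wpM2r// lerDl.
  rewrite mulrC -ltr_pdivlMr ?ltr_wpDl//.
  by near: u; apply: cvgr_distC_lt => //; rewrite divr_gt0// ltr_wpDl.
exists y; split.
- apply: (@cvg_unique _ _ (euler k 0 @[k --> U])); [exact: norm_hausdorff|exact: yP|].
  by rewrite (_ : (fun k => _) = fun=> x0); [exact: cvg_cst|apply/funext => k; exact: euler0].
- move=> s s' s0 ss'.
  have c1 : `|euler k s' - euler k s| @[k --> U] --> `|y s' - y s|.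
    by apply: cvg_norm; apply: cvgB; exact: yP.
  have c2 : (s' - s + tau k) * M @[k --> U] --> (s' - s + 0) * M.
    by apply: cvgM; [apply: cvgD => //; exact: cvg_cst|exact: cvg_cst].
  rewrite mulrC -[s' - s]addr0; apply: (ler_cvg_to c1 c2).
  by near=> k; exact: incr.
- move=> s s' s0 ss'.
  have c1 : `|euler k s' - euler k s - (s' - s) *: F (euler k s)| @[k --> U] -->
            `|y s' - y s - (s' - s) *: F (y s)|.
    apply: cvg_norm; apply: cvgB; first by apply: cvgB; exact: yP.
    by apply: cvgZl_tmp; apply: (@cvg_comp _ _ _ (fun k => euler k s) F); [exact: yP|exact: FC].
  have c2 : L * M * (s' - s + tau k) ^+ 2 + tau k * M @[k --> U] -->
            L * M * (s' - s + 0) ^+ 2 + 0 * M.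
    apply: cvgD; last by apply: cvgM => //; exact: cvg_cst.
    apply: cvgM; first exact: cvg_cst.
    by rewrite expr2; apply: cvgM; apply: cvgD => //; exact: cvg_cst.
  suff : `|y s' - y s - (s' - s) *: F (y s)| <= L * M * (s' - s + 0) ^+ 2 + 0 * M.
    by rewrite mul0r !addr0.
  apply: (ler_cvg_to c1 c2); near=> k.
  have [p [-> ps]] := euler_increment k s s' s0 ss'.
  set v := euler k s; rewrite -/(tau k) in ps *.
  (* The p steps cover s' - s only up to one step; this discrepancy costs at most [tau k * M], which
     vanishes in the limit. *)
  have -> : iter p (step (tau k)) v - v - (s' - s) *: F v =
    (iter p (step (tau k)) v - v - (p%:R * tau k) *: F v) +
    (p%:R * tau k - (s' - s)) *: F v.
    by rewrite (scalerBl (p%:R * tau k)) addrA subrK.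
  apply: le_trans (ler_normD _ _) _; apply: lerD.
    apply: le_trans (euler_quadratic _ _ _ (ltW (tau0 k))) _.
    apply: ler_wpM2l; first exact: mulr_ge0.
    have a1 : 0 <= p%:R * tau k by rewrite mulr_ge0// ltW.
    have a2 : p%:R * tau k <= s' - s + tau k by move: ps; rewrite ler_norml; lra.
    by rewrite lerXn2r// nnegrE// (le_trans a1).
  by rewrite normrZ; apply: ler_pM.
Unshelve. all: by end_near. Qed.

End Euler.

Section ODE.
Context {R : realType} {V : normedModType R}.

(** The past is the forward solution of the field -F, run backwards, and the two halves are glued at
    time 0. Their quadratic remainder bounds yield the derivative. *)
Lemma ode_exists (F : V -> V) (M L : R) (x0 : V) : finite_dim V -> 0 <= L ->
  (forall v, `|F v| <= M) -> (forall u v, `|F u - F v| <= L * `|u - v|) ->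
  exists y : R -> V, [/\ y 0 = x0, forall s : R, is_derive s 1 y (F (y s)) &
    forall s, `|y s - x0| <= M * `|s|].
Proof.
move=> fV L0 FM FL.
have M0 : 0 <= M by apply: le_trans (FM 0).
have [yF [yF0 yF1 yF2]] := ode_forward F M L FM FL L0 x0 fV.
have FM' v : `|- F v| <= M by rewrite normrN.
have FL' u v : `|- F u - - F v| <= L * `|u - v| by rewrite -opprD normrN.
have [yB [yB0 yB1 yB2]] := ode_forward (fun v => - F v) M L FM' FL' L0 x0 fV.
(* The forward bound expands at the earlier time. Expanding at the later one adds the variation of
   the field between the two points, hence the factor 2. *)
have two (G : V -> V) (y : R -> V) (s s' : R) :
    (forall u v, `|G u - G v| <= L * `|u - v|) ->
    (forall s s', 0 <= s -> s <= s' -> `|y s' - y s| <= M * (s' - s)) ->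
    (forall s s', 0 <= s -> s <= s' ->
      `|y s' - y s - (s' - s) *: G (y s)| <= L * M * (s' - s) ^+ 2) ->
    0 <= s -> 0 <= s' ->
    `|y s' - y s - (s' - s) *: G (y s)| <= 2 * (L * M) * (s' - s) ^+ 2.
  move=> GL y1 y2 s0 s'0.
  have LM2 : 0 <= L * M * (s' - s) ^+ 2 by rewrite mulr_ge0 ?sqr_ge0// mulr_ge0.
  have [ss'|/ltW s's] := leP s s'.
    by apply: le_trans (y2 _ _ s0 ss') _; rewrite -mulrA; lra.
  have -> : y s' - y s - (s' - s) *: G (y s) =
     - (y s - y s' - (s - s') *: G (y s')) + (s - s') *: (G (y s) - G (y s')).
    rewrite -(opprB s s') scaleNr opprK [RHS]addrC opprB scalerBr addrA subrK.
    by rewrite opprB addrC.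
  apply: le_trans (ler_normD _ _) _; rewrite normrN normrZ.
  apply: le_trans (lerD (y2 _ _ s'0 s's) (ler_wpM2l _ (GL _ _))) _ => //.
  have := ler_wpM2l L0 (y1 _ _ s'0 s's); rewrite ger0_norm ?subr_ge0// => h.
  have : (s - s') * (L * `|y s - y s'|) <= (s - s') * (L * (M * (s - s'))).
    by rewrite ler_wpM2l// subr_ge0.
  by nra.
pose y s := if 0 <= s then yF s else yB (- s).
have yN s : s <= 0 -> y s = yB (- s).
  move=> s0; rewrite /y; case: ifP => // s0'.
  by have -> : s = 0 by [apply/eqP; rewrite eq_le s0 s0']; rewrite oppr0 yF0 yB0.
have yP s : 0 <= s -> y s = yF s by rewrite /y => ->.
have quad s s' : (0 <= s /\ 0 <= s') \/ (s <= 0 /\ s' <= 0) ->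
    `|y s' - y s - (s' - s) *: F (y s)| <= 2 * (L * M) * (s' - s) ^+ 2.
  move=> [[s0 s0']|[s0 s0']].
    by rewrite !yP//; exact: (two F).
  rewrite !yN//; have := two _ yB (- s) (- s') FL' yB1 yB2.
  rewrite !oppr_ge0 => /(_ s0 s0').
  by rewrite -opprD sqrrN scaleNr scalerN opprK.
exists y; split; first by rewrite yP.
  move=> s; apply: (is_derive_quadratic _ _ (2 * (L * M))).
  have sq h := quad s (s + h).
  (* For s different from 0 a small h keeps s + h on the same side; at s = 0 either side is
     admissible, so the two halves join with one derivative. *)
  have [s0|s0|s0] := ltgtP s 0; near=> h; have := sq h; rewrite [s + h - s]addrC addKr; apply.
  - right; split; first exact: ltW.
    have : `|h| < - s.
      by near: h; exists (- s) => [|z] /=; rewrite ?sub0r ?normrN// oppr_gt0.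
    by move=> /(le_lt_trans (ler_norm _)); lra.
  - left; split; first exact: ltW.
    have : `|h| < s by near: h; exists s => [|z] /=; rewrite ?sub0r ?normrN.
    by rewrite ltr_norml; lra.
  - rewrite s0 add0r; have [|/ltW] := leP 0 h; by [left|right].
move=> s; have [s0|/ltW s0] := leP 0 s.
  by have := yF1 0 s (lexx _) s0; rewrite subr0 yF0 ger0_norm// yP.
have s0' : 0 <= - s by rewrite oppr_ge0.
by have := yB1 0 (- s) (lexx _) s0'; rewrite subr0 yB0 ler0_norm// yN.
Unshelve. all: by end_near. Qed.

End ODE.

(** * Mean value and comparison estimates for curves *)

Section VectorMeanValue.
Context {R : realType} {m : nat}.
Local Notation S := 'rV[R]_m.

(** The norm is the maximum of the entries, so the scalar theorem applied to each entry loses no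
    constant. *)
Lemma MVT_rV (f : R -> S) (a b B : R) : a <= b ->
  (forall t, a <= t <= b -> derivable f t 1) ->
  (forall t, a < t < b -> `|'D_1 f t| <= B) ->
  0 <= B -> `|f b - f a| <= B * (b - a).
Proof.
rewrite le_eqVlt => /orP[/eqP ->|ab] fd fB B0; first by rewrite !subrr normr0 mulr0.
have ba : 0 <= b - a by rewrite subr_ge0 ltW.
apply: mx_norm_le => [|i j]; first exact: mulr_ge0.
have fdij t : a <= t <= b -> derivable (fun t => f t i j) t 1.
  by move=> /fd /derivable_mxP; apply.
have [||c] := @MVT R (fun t => f t i j) (fun t => 'D_1 f t i j) a b ab.
- move=> t; rewrite in_itv /= => /andP[at_ tb].
  have tab : a <= t <= b by rewrite !ltW.
  by rewrite derive_mx ?mxE; [exact: DeriveDef (fdij _ tab) _|exact: fd].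
- apply: derivable_within_continuous => t.
  by rewrite in_itv /=; exact: fdij.
rewrite in_itv /= => cab; rewrite !mxE => ->.
rewrite normrM (ger0_norm ba); apply: ler_wpM2r => //.
exact: le_trans (mx_entry_le _ _ _ _ _) (fB _ cab).
Qed.

(** Continuation argument: up to the supremum of the times until which the bound holds, the speed is
    at most B, so the curve has moved by less than 1 and is strictly inside. By continuity the bound
    would persist beyond a supremum smaller than t + h. *)
Lemma stays_in_ball (x : R -> S) (r B t h : R) : 0 <= B -> 0 <= h -> h * B < 1 ->
  (forall s, t <= s <= t + h -> derivable x s 1) ->
  (forall s, t <= s <= t + h -> `|x s| <= r + 1 -> `|'D_1 x s| <= B) ->
  `|x t| <= r -> forall s, t <= s <= t + h -> `|x s| <= r + 1.
Proof.
move=> B0 h0 hB xd xB xt.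
pose A := [set s | t <= s <= t + h /\ forall u, t <= u <= s -> `|x u| <= r + 1].
have At : A t.
  split; first by rewrite lexx lerDl.
  by move=> u; rewrite -eq_le => /eqP <-; lra.
have A0 : A !=set0 by exists t.
have Aub : ubound A (t + h) by move=> s [/andP[]].
have Abd : has_ubound A by exists (t + h).
have tsup : t <= sup A by exact: ub_le_sup.
have suph : sup A <= t + h by exact: ge_sup.
have low u : t <= u -> u < sup A -> `|x u| <= r + 1.
  move=> tu /(sup_gt A0)[s [_ As] us]; apply: As; rewrite tu ltW//.
have low' u : t <= u <= sup A -> `|x u| < r + 1.
  move=> /andP[tu us].
  have uh := le_trans us suph.
  rewrite -[x u](subrK (x t)) addrC.
  apply: le_lt_trans (ler_normD _ _) _; apply: ler_ltD => //.
  apply: (@le_lt_trans _ _ (B * (u - t))).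
    apply: MVT_rV => // s /andP[ts su]; first by apply: xd; rewrite ts (le_trans su).
    apply: xB; first by rewrite !ltW// (lt_le_trans su).
    by apply: low; [exact: ltW|exact: lt_le_trans us].
  apply: le_lt_trans hB; rewrite mulrC ler_wpM2r//; lra.
have supE : sup A = t + h.
  apply/eqP; rewrite eq_le suph leNgt; apply/negP => supl.
  have xc : {for sup A, continuous x}.
    apply: differentiable_continuous; apply/derivable1_diffP; apply: xd.
    by rewrite tsup suph.
  have xlt : `|x (sup A)| < r + 1 by apply: low'; rewrite tsup lexx.
  have /nbhs_ballP[e /= e0 xe] : \forall s \near sup A, `|x s| < r + 1.
    have nc : {for sup A, continuous (fun s => `|x s|)}.
      by apply: (@cvg_comp _ _ _ x (fun v => `|v|)); [exact: xc|exact: norm_continuous].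
    exact: (cvgr_lt _ nc).
  pose s' := Num.min (sup A + e / 2) (t + h).
  have e2 : 0 < e / 2 by rewrite divr_gt0.
  have ss' : sup A < s' by rewrite lt_min supl ltrDl e2.
  suff : s' <= sup A by rewrite leNgt ss'.
  apply: ub_le_sup => //; split.
    by rewrite (le_trans tsup (ltW ss')) ge_min lexx orbT.
  move=> u /andP[tu us']; have [us|us] := leP u (sup A).
    by apply/ltW/low'; rewrite tu.
  apply/ltW/xe; rewrite /ball /= distrC gtr0_norm ?subr_gt0//.
  by move: us'; rewrite le_min => /andP[? _]; lra.
by move=> s; rewrite -supE => /low'/ltW.
Qed.

(** Replaces Gronwall's inequality on a short interval: the maximal distance w satisfies w <= (L w +
    d) h, and h L <= 1/2 absorbs the term in w. *)
Lemma compare_with_solution (F : S -> S) (x y : R -> S) (L d t h : R) :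
  (forall u v, `|F u - F v| <= L * `|u - v|) ->
  0 <= L -> 0 <= d -> 0 <= h -> h * L <= 1 / 2 ->
  (forall s, t <= s <= t + h -> derivable x s 1) ->
  (forall s, t <= s <= t + h -> is_derive s 1 y (F (y s))) ->
  (forall s, t <= s <= t + h -> `|'D_1 x s - F (x s)| <= d) ->
  x t = y t -> `|x (t + h) - y (t + h)| <= 2 * h * d.
Proof.
move=> FL L0 d0 h0 hL xd yd xF xy.
have th : t <= t + h by rewrite lerDl.
pose z s := x s - y s.
have zd s : t <= s <= t + h -> derivable z s 1.
  by move=> sth; apply: derivableB; [exact: xd|have [] := yd s sth].
have zD s : t <= s <= t + h -> 'D_1 z s = 'D_1 x s - F (y s).
  move=> sth; have [yds <-] := yd s sth; rewrite deriveB//; exact: xd.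
have zc : {within `[t, t + h], continuous (fun s => `|z s|)}.
  have : {within `[t, t + h], continuous z}.
    by apply: derivable_within_continuous => s; rewrite in_itv; exact: zd.
  by move=> zc s; apply: (@cvg_comp _ _ _ z (fun v => `|v|)); [exact: zc|exact: norm_continuous].
have [c] := EVT_max th zc; rewrite in_itv /= => /andP[tc ch] zmax.
have zle : `|z c| <= (L * `|z c| + d) * (c - t).
  have zt : z t = 0 by rewrite /z /= xy subrr.
  have := @MVT_rV z t c (L * `|z c| + d) tc; rewrite zt subr0; apply.
  - by move=> s /andP[ts sc]; apply: zd; rewrite ts (le_trans sc).
  - move=> s /andP[ts sc]; have sth : t <= s <= t + h by rewrite !ltW// (lt_le_trans sc).
    rewrite zD// -[X in X - _](subrK (F (x s))) -addrA addrC.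
    apply: le_trans (ler_normD _ _) _; apply: lerD; last exact: xF.
    apply: le_trans (FL _ _) _; rewrite ler_wpM2l//.
    by have := zmax s; rewrite in_itv /=; apply.
  - by rewrite addr_ge0// mulr_ge0.
have zh : `|z (t + h)| <= `|z c| by apply: zmax; rewrite in_itv /= th lexx.
apply: (le_trans zh).
have := normr_ge0 (z c); move: zle zh; set w := `|z c| => zle _ w0.
have : (L * w + d) * (c - t) <= (L * w + d) * h.
  by apply: ler_wpM2l; [rewrite addr_ge0// mulr_ge0|lra].
have : h * L * w <= 1 / 2 * w by exact: ler_wpM2r.
lra.
Qed.

End VectorMeanValue.

(** * Taylor expansion and polynomial families *)

Section PolyCoef.
Context {R : comNzRingType}.
Implicit Types p q : {poly R}.

(** Allows a series to be truncated at different orders when only low coefficients of its powers are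
    read. *)
Lemma coef_exp_agree p q (k r : nat) :
  (forall i, (i <= k)%N -> p`_i = q`_i) ->
  forall i, (i <= k)%N -> (p ^+ r)`_i = (q ^+ r)`_i.
Proof.
move=> pq; elim: r => [//|r IH] i ik.
rewrite !exprS !coefM; apply: eq_bigr => j _.
by rewrite pq ?IH// (leq_trans _ ik) ?leq_subr// -ltnS.
Qed.

Lemma coef_exp_low p (r i : nat) : p`_0 = 0 -> (i < r)%N -> (p ^+ r)`_i = 0.
Proof.
move=> p0; elim: r i => [//|r IH] i ir; rewrite exprS coefM big1// => -[j jlt] _ /=.
case: j jlt => [|j] jlt; first by rewrite p0 mul0r.
by rewrite IH ?mulr0//; lia.
Qed.

Lemma coef_trunc_series (e : nat -> R) k i :
  ((\sum_(j < k.+1 | (0 < j)%N) e j *: 'X^j) : {poly R})`_i =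
  if (0 < i <= k)%N then e i else 0.
Proof.
rewrite coef_sum; under eq_bigr do rewrite coefZ coefXn.
case: ifP => [/andP[i0 ik]|/negbT ik].
  rewrite (bigD1 (Ordinal (ik : (i < k.+1)%N)))//= eqxx mulr1 big1 ?addr0//.
  move=> j /andP[_ ji]; case: eqP => [ij|]; last by rewrite mulr0.
  by rewrite -val_eqE /= -ij eqxx in ji.
rewrite big1// => j j0; case: eqP => [ij|]; last by rewrite mulr0.
by move: ik; rewrite ij j0 /= -ltnNge ltnNge -ltnS ltn_ord.
Qed.

Lemma sum_ord_trim (F : nat -> R) (a b : nat) : (a <= b)%N ->
  (forall i, (a <= i)%N -> F i = 0) -> \sum_(i < b) F i = \sum_(i < a) F i.
Proof.
move=> ab F0; rewrite (big_ord_widen _ _ ab) [RHS]big_mkcond /=; apply: eq_bigr => i _.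
by case: ltnP => // /F0.
Qed.

End PolyCoef.

Section Taylor.
Context {R : realType}.

Lemma derive1nSr (f : R -> R) r : derive1n r.+1 f = derive1n r (derive1 f).
Proof. by elim: r => [//|r IH] /=; rewrite -IH. Qed.

Lemma Ck_derive1 (f : R -> R) k : Ck k.+1 f -> Ck k (derive1 f).
Proof.
move=> [_ _ fD]; rewrite (_ : derive1 f = 'D_1 f); first exact: fD.
by apply/funext => t; rewrite derive1E.
Qed.

Lemma Ck_power_sum k (c : nat -> R) m : Ck k (fun d : R => \sum_(r < m) c r * d ^+ r).
Proof.
apply: Ck_sum => r _; apply: Ck_mul; first exact: Ck_cst.
by apply/Ck_exp/Ck_lin => // t; exact: cvg_id.
Qed.

Lemma is_derive_power_sum (c : nat -> R) m (d : R) :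
  is_derive d 1 (fun d : R => \sum_(r < m.+1) c r * d ^+ r)
    (\sum_(r < m) c r.+1 * r.+1%:R * d ^+ r).
Proof.
elim: m => [|m IH].
  rewrite big_ord0 (_ : (fun _ => _) = fun=> c 0%N); first exact: is_derive_cst.
  by apply/funext => t; rewrite big_ord1 expr0 mulr1.
rewrite big_ord_recr /=.
rewrite (_ : (fun t => _) = (fun t => \sum_(r < m.+1) c r * t ^+ r) + (fun t => c m.+1 * t ^+ m.+1)); last first.
  by apply/funext => t; rewrite big_ord_recr.
apply: is_deriveD.
rewrite (_ : (fun t => _) = c m.+1 \*: ((@id R) ^+ m.+1)); last first.
  by apply/funext => t; rewrite exprfctE.
apply: (is_derive_eq (is_deriveZ _ (is_deriveX _ (is_derive_id d 1)))).
by rewrite /GRing.scale /= mulr1 mulrA.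
Qed.

(** The derivative of the remainder is the remainder of one order less for f', and the mean value
    theorem supplies the missing factor d. The factor 1/m! is given up. *)
Lemma taylor_bound (f : R -> R) (a rho B : R) m :
  (forall k, Ck k f) -> (forall t, `|t - a| <= rho -> `|derive1n m f t| <= B) ->
  forall d, `|d| <= rho ->
  `|f (a + d) - \sum_(r < m) derive1n r f a / r`!%:R * d ^+ r| <= B * `|d| ^+ m.
Proof.
elim: m f => [|m IH] f fC fB d drho.
  rewrite big_ord0 subr0 expr0 mulr1; apply: (fB (a + d)).
  by rewrite addrC addKr.
pose c r := derive1n r f a / r`!%:R.
pose psi (d : R) := f (a + d) - \sum_(r < m.+1) c r * d ^+ r.
have fD (t : R) : is_derive t 1 (fun d => f (a + d)) (derive1 f (a + t)).
  have [_ fd _] := fC 1%N.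
  have := is_derive_line f a 1 t; rewrite derive1E [t *: 1]mulr1 => /(_ (fd _ _)).
  by congr (is_derive _ _ _ _); apply/funext => s; rewrite [s *: 1]mulr1.
have psiD (t : R) : is_derive t 1 psi (derive1 f (a + t) -
    \sum_(r < m) derive1n r (derive1 f) a / r`!%:R * t ^+ r).
  have := is_deriveB (fD t) (is_derive_power_sum c m t).
  move=> H; apply: (is_derive_eq H); congr (_ - _); apply: eq_bigr => r _.
  congr (_ * _); rewrite /c derive1nSr factS natrM invfM -!mulrA; congr (_ * _).
  by rewrite mulrCA mulVf ?mulr1// pnatr_eq0.
have psiC : Ck 1 psi.
  have fC' : Ck 1 (fun d => f (a + d)).
    apply: (Ck_comp_aff R R 1 f (fun d => a + d) id) => //.
      by move=> s x y; rewrite addrA.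
    by move=> x; apply: cvgD; [exact: cvg_cst|exact: cvg_id].
  by apply: Ck_add => //; apply/Ck_opp/Ck_power_sum.
have psi0 : psi 0 = 0.
  rewrite /psi addr0 big_ord_recl /= expr0 mulr1 big1 ?addr0; last first.
    by move=> i _; rewrite exprS mul0r mulr0.
  by rewrite /c /= fact0 divr1 subrr.
have [e ed] := MVT_line psi 0 1 d psiC.
rewrite add0r [d *: 1]mulr1 psi0 subr0 => psid.
rewrite -[X in `|X|]/(psi d) psid.
rewrite add0r [e *: 1]mulr1; have [_ ->] := psiD e.
rewrite normrM exprS mulrCA ler_wpM2l//.
have B0 : 0 <= B by apply: le_trans (fB a _); rewrite ?subrr ?normr0// (le_trans _ drho).
have erho := le_trans ed drho.
apply: (@le_trans _ _ (B * `|e| ^+ m)).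
  apply: IH => // [k|t tr]; first exact: Ck_derive1.
  by rewrite -derive1nSr; exact: fB.
by rewrite ler_wpM2l// lerXn2r ?nnegrE.
Qed.

End Taylor.

Section PolyFamilies.
Context {R : realType} {V : normedModType R}.

(** Truncated power series in h with coefficients depending on x are kept as polynomials, with
    regularity in x asked of each coefficient. *)
Definition Ckpoly (k : nat) (P : V -> {poly R}) : Prop :=
  forall i, Ck k (fun x => (P x)`_i).

Lemma Ckpoly_exp k P r : Ckpoly k P -> Ckpoly k (fun x => P x ^+ r).
Proof.
move=> PC; elim: r => [|r IH] i.
  by apply: Ck_ext (Ck_cst _ _ (1%:P : {poly R})`_i) => x; rewrite expr0.
apply: (Ck_ext _ _ (fun x => \sum_(j < i.+1) (P x)`_j * (P x ^+ r)`_(i - j))).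
  by move=> x; rewrite exprS coefM.
by apply: Ck_sum => j _; apply: Ck_mul; [exact: PC|exact: IH].
Qed.

(** For h in [0, 1] every surviving power is at most h^p, and the common degree bound leaves
    finitely many coefficients to bound on the ball. *)
Lemma poly_small (Q : V -> {poly R}) (d p : nat) (r : R) : finite_dim V ->
  Ckpoly 0 Q -> (forall x, (size (Q x) <= d)%N) ->
  (forall x k, (k < p)%N -> (Q x)`_k = 0) ->
  exists2 C, 0 <= C & forall x h, `|x| <= r -> 0 <= h <= 1 ->
    `|(Q x).[h]| <= C * h ^+ p.
Proof.
move=> fV QC Qd Q0.
have /choice[B BP] : forall i, exists B, 0 <= B /\ forall x, `|x| <= r -> `|(Q x)`_i| <= B.
  by move=> i; have [B] := bounded_on_ball fV _ r (QC i); exists B.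
exists (\sum_(i < d) B i); first by apply: sumr_ge0 => i _; have [] := BP i.
move=> x h xr /andP[h0 h1].
rewrite (horner_coef_wide _ (Qd x)) mulr_suml.
apply: le_trans (ler_norm_sum _ _ _) _; apply: ler_sum => i _.
have [B0 BQ] := BP i.
have [ip|ip] := ltnP i p; first by rewrite Q0// mul0r normr0 mulr_ge0// exprn_ge0.
rewrite normrM normrX (ger0_norm h0); apply: ler_pM => //; [exact: exprn_ge0|exact: BQ|].
exact: ler_wiXn2l.
Qed.

End PolyFamilies.

(** * The formal series *)

Lemma Ck_iterD {R : realType} {V : normedModType R} (F : V -> R) v r k :
  Ck (r + k) F -> Ck k (Defs.iterD (nseq r v) F).
Proof.
elim: r k => [//|r IH] k; rewrite addSnnS => /IH /CkS[_ _].
by apply.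
Qed.

Lemma finite_dim_phase {R : realType} {n : nat} :
  finite_dim ('rV[R]_(n + n) * R : Type).
Proof. by apply: finite_dim_prod; [exact: finite_dim_rV|exact: finite_dim_R]. Qed.

Section FormalSeries.
Context {R : realType} {n : nat}.
Local Notation S := 'rV[R]_(n + n).
Variables (H N : S -> R) (K : nat -> S -> R -> R) (Ec : nat -> S -> R).
Hypotheses (Hs : smooth H) (Ns : smooth N) (N0 : forall x, 0 < N x).
Hypothesis K0E : forall x E, K 0%N x E = N x * (H x - E).
Hypothesis Ks : forall j, smooth (fun z : S * R => K j z.1 z.2).
Hypothesis EcH : Ec 0%N = H.
Hypothesis comp0 : forall k x, comp_coeff K Ec k x = 0.

(** Expresses derivatives in E at fixed x through the joint function, so that they depend smoothly
    on x and E together. *)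
Lemma derive1n_iterD j r x E :
  derive1n r (K j x) E =
  Defs.iterD (nseq r ((0, 1) : S * R)) (fun z : S * R => K j z.1 z.2) (x, E).
Proof.
elim: r E => [//|r IH] E; rewrite derive1nS derive1E /=.
set G := Defs.iterD _ _ in IH *.
have [_ Gd _] : Ck 1 G by apply: Ck_iterD; exact: smooth_Ck.
have lineE t : (x, 0) + t *: (0, 1) = (x, t) :> S * R.
  by rewrite pair_line scaler0 addr0 add0r mulr1.
have := is_derive_line G (x, 0) (0, 1) E; rewrite lineE => /(_ (Gd _ _)) [_ <-].
by congr ('D_1 _ E); apply/funext => t; rewrite lineE; exact: IH.
Qed.

Lemma Ck_fiber j k x : Ck k (K j x).
Proof.
apply: (Ck_comp_aff R (S * R : Type) k (fun z : S * R => K j z.1 z.2)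
  (fun E => (x, E)) (fun E => (0, E))).
- by move=> s E E'; rewrite pair_line scaler0 addr0.
- by move=> E; exact: (cvg_pair (cvg_cst x) (@cvg_id _ (nbhs E))).
- exact: smooth_Ck.
Qed.

Definition taylor_coef (j r : nat) (x : S) : R :=
  derive1n r (K j x) (Ec 0%N x) / r`!%:R.

Lemma Ck_taylor_coef j r k : Ck k (taylor_coef j r).
Proof.
apply: Ck_mul; last exact: Ck_cst.
pose G := Defs.iterD (nseq r ((0, 1) : S * R)) (fun z : S * R => K j z.1 z.2).
apply: (Ck_ext _ _ (fun x => G (x, Ec 0%N x))).
  by move=> x; rewrite derive1n_iterD.
apply: (Ck_comp_pair S S k G id id) => //; first by move=> x; exact: cvg_id.
  by apply: Ck_iterD; exact: smooth_Ck.
by rewrite EcH; exact: smooth_Ck.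
Qed.

(** The truncated energy minus its constant term, as a polynomial in h: the increment at which the
    Taylor expansion in E is evaluated. *)
Definition series_poly (m : nat) (x : S) : {poly R} :=
  \sum_(i < m.+1 | (0 < i)%N) Ec i x *: 'X^i.

Lemma comp_coeffE k x : comp_coeff K Ec k x =
  \sum_(j < k.+1) \sum_(r < k.+1) (taylor_coef j r x * (series_poly k x ^+ r)`_(k - j)).
Proof. by []. Qed.

Lemma coef_series_poly m x i :
  (series_poly m x)`_i = if (0 < i <= m)%N then Ec i x else 0.
Proof. exact: (coef_trunc_series (fun i => Ec i x)). Qed.

Lemma derive1_K0 x : derive1 (K 0%N x) = fun=> - N x.
Proof.
apply/funext => E; rewrite derive1E; apply: derive_val; apply/is_deriveP.
apply: cvg_near_cst; near=> h; rewrite !K0E [h *: 1]mulr1.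
rewrite (_ : N x * (H x - (E + h)) - N x * (H x - E) = h * - N x); last by ring.
by rewrite [LHS]mulKf//; near: h; exact: nbhs_dnbhs_neq.
Unshelve. all: by end_near. Qed.

Lemma taylor_coef01 x : taylor_coef 0 1 x = - N x.
Proof. by rewrite /taylor_coef factS fact0 muln1 divr1 derive1n1 derive1_K0. Qed.

Lemma taylor_coef0_ge2 r x : taylor_coef 0 r.+2 x = 0.
Proof.
rewrite /taylor_coef (_ : derive1n r.+2 _ = fun=> 0) ?mul0r//.
elim: r => [|r IH]; rewrite derive1nS.
  by rewrite derive1n1 derive1_K0; apply/funext => E; rewrite derive1_cst.
by rewrite IH; apply/funext => E; rewrite derive1_cst.
Qed.

(* the order-k equation is linear in Ec k with leading factor -N, because K 0 is
   affine in E *)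
Lemma Ec_recursion k x : Ec k.+1 x = (N x)^-1 *
  \sum_(j < k.+1) \sum_(r < k.+2)
     taylor_coef j.+1 r x * (series_poly k x ^+ r)`_(k - j).
Proof.
have := comp0 k.+1 x; rewrite comp_coeffE big_ord_recl /=.
rewrite big_ord_recl /= expr0 coef1 /= mulr0 add0r.
rewrite big_ord_recl /= expr1 coef_series_poly /= leqnn taylor_coef01 subn0.
rewrite big1 ?addr0; last by move=> i _; rewrite /bump /= !add1n taylor_coef0_ge2 mul0r.
move=> /eqP; rewrite mulNr addrC subr_eq0 => /eqP E.
rewrite -[LHS](mulKf (lt0r_neq0 (N0 x))) -E; congr (_ * _).
apply: eq_bigr => -[j jk] _; apply: eq_bigr => r _ /=.
rewrite /bump /= add1n subSS; congr (_ * _).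
(* The coefficients read have index k - j <= k, so the series may be cut at order k; the right-hand
   side then involves only earlier [Ec i]. *)
apply: (@coef_exp_agree _ _ _ k); last exact: leq_subr.
move=> i ik; rewrite !coef_series_poly.
by rewrite ik (leq_trans ik).
Qed.

Lemma Ck_series_poly k m : (forall i, (i <= m)%N -> Ck k (Ec i)) ->
  Ckpoly k (series_poly m).
Proof.
move=> EC i; case im : (0 < i <= m)%N; last first.
  by apply: Ck_ext (Ck_cst _ _ 0) => x; rewrite coef_series_poly im.
have /andP[_ im'] := im.
by apply: Ck_ext (EC _ im') => x; rewrite coef_series_poly im.
Qed.

(** Strong induction on the recursion, which combines smooth functions and earlier coefficients and
    divides by the positive [N]. *)
Lemma Ec_Ck k i : Ck k (Ec i).
Proof.
elim/ltn_ind: i => -[|i] IH; first by rewrite EcH; exact: smooth_Ck.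
apply: (Ck_ext _ _ _ _ (fun x => esym (Ec_recursion i x))).
apply: Ck_mul.
  by apply: Ck_inv; [move=> x; rewrite lt0r_neq0|exact: smooth_Ck].
apply: Ck_sum => j _; apply: Ck_sum => r _; apply: Ck_mul; first exact: Ck_taylor_coef.
by apply: Ckpoly_exp; exact: Ck_series_poly.
Qed.

Lemma Etrunc_series m h x : Etrunc Ec m h x = Ec 0%N x + (series_poly m x).[h].
Proof.
rewrite /Etrunc /series_poly big_ord_recl /= expr0 mul1r; congr (_ + _).
rewrite horner_sum [RHS]big_mkcond [RHS]big_ord_recl /= add0r; apply: eq_bigr => i _.
by rewrite hornerZ hornerXn mulrC.
Qed.

(** The truncated modified Hamiltonian at the truncated energy, with each K_j replaced by its Taylor
    polynomial in E of degree m about E_0. *)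
Definition formal_value (m : nat) (x : S) : {poly R} :=
  \sum_(j < m.+1) 'X^j * \sum_(r < m.+1) taylor_coef j r x *: series_poly m x ^+ r.

Lemma coef_formal_value m x i : (formal_value m x)`_i =
  \sum_(j < m.+1) if (i < j)%N then 0 else
    \sum_(r < m.+1) taylor_coef j r x * (series_poly m x ^+ r)`_(i - j).
Proof.
rewrite coef_sum; apply: eq_bigr => j _; rewrite coefXnM; case: ifP => // _.
by rewrite coef_sum; apply: eq_bigr => r _; rewrite coefZ.
Qed.

Lemma Ckpoly_formal_value k m : Ckpoly k (formal_value m).
Proof.
move=> i; apply: (Ck_ext _ _ _ _ (fun x => esym (coef_formal_value m x i))).
apply: Ck_sum => j _; case: (i < j)%N; first exact: Ck_cst.
apply: Ck_sum => r _; apply: Ck_mul; first exact: Ck_taylor_coef.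
have PC : Ckpoly k (series_poly m) by apply: Ck_series_poly => p _; exact: Ec_Ck.
exact: (Ckpoly_exp k _ r PC).
Qed.

Lemma size_formal_value m x : (size (formal_value m x) <= m + (m * m).+1)%N.
Proof.
apply/leq_sizeP => i ib; rewrite coef_formal_value big1// => j _.
case: ifP => // _; rewrite big1// => r _.
rewrite nth_default ?mulr0//.
have sP : (size (series_poly m x) <= m.+1)%N.
  by apply/leq_sizeP => p mp; rewrite coef_series_poly [(p <= m)%N]leqNgt mp andbF.
have := size_poly_exp_leq (series_poly m x) r.
have := ltn_ord j; have := ltn_ord r.
set sp := size _ in sP *; set sr := size _ => rm jm sr_le.
have : ((sp.-1 * r) <= m * m)%N by apply: leq_mul; lia.
lia.
Qed.

(** Up to degree m its coefficients are those of the formal series: terms with j > k are shifted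
    beyond degree k, and an r-th power of a series without constant term starts at degree r. *)
Lemma formal_value_coef0 m x k : (k < m.+1)%N -> (formal_value m x)`_k = 0.
Proof.
move=> km; rewrite -[RHS](comp0 k x) comp_coeffE coef_formal_value.
rewrite (@sum_ord_trim R (fun j => if (k < j)%N then 0 else
    \sum_(r < m.+1) taylor_coef j r x * (series_poly m x ^+ r)`_(k - j)) k.+1)//; last first.
  by move=> i ->.
apply: eq_bigr => j _; rewrite ltnNge -ltnS ltn_ord /=.
rewrite (@sum_ord_trim R (fun r => taylor_coef j r x * (series_poly m x ^+ r)`_(k - j)) k.+1)//.
  apply: eq_bigr => r _; congr (_ * _).
  apply: (@coef_exp_agree _ _ _ k); last exact: leq_subr.
  by move=> i ik; rewrite !coef_series_poly ik (leq_trans ik).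
move=> r kr; rewrite coef_exp_low ?mulr0//; first by rewrite coef_series_poly.
exact: leq_ltn_trans (leq_subr _ _) kr.
Qed.

(** The value is [formal_value], which has only powers of h above m, plus Taylor remainders of order
    m + 1 in an increment d = O(h). *)
Lemma Kmod_Etrunc_small m r : exists2 C, 0 <= C &
  forall x h, `|x| <= r -> 0 <= h <= 1 ->
    `|Kmod K m x h (Etrunc Ec m h x)| <= C * h ^+ m.+1.
Proof.
have fS : finite_dim S := finite_dim_rV _.
have [C1 C10 C1P] := poly_small _ _ _ r fS (Ckpoly_formal_value 0 m) (size_formal_value m)
  (formal_value_coef0 m).
have [D D0 DP] : exists2 D, 0 <= D & forall x h, `|x| <= r -> 0 <= h <= 1 ->
    `|(series_poly m x).[h]| <= D * h ^+ 1.
  apply: (poly_small _ m.+1) => //.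
  - by apply: Ck_series_poly => *; exact: Ec_Ck.
  - move=> x; apply/leq_sizeP => p mp.
    by rewrite coef_series_poly [(p <= m)%N]leqNgt mp andbF.
  - by move=> x [|//] _; rewrite coef_series_poly.
have [BH BH0 BHP] := bounded_on_ball fS _ r (Ck_continuous _ _ (Ec_Ck 0 0)).
(* [D] is also a radius in E that contains all increments, since |d| <= D h <= D. *)
have /choice[B BP] : forall j, exists B, 0 <= B /\ forall x t, `|x| <= r ->
    `|t - Ec 0%N x| <= D -> `|derive1n m.+1 (K j x) t| <= B.
  move=> j.
  pose G := Defs.iterD (nseq m.+1 ((0, 1) : S * R)) (fun z : S * R => K j z.1 z.2).
  have Gc : continuous G by apply: (Ck_iterD _ _ _ 0); exact: smooth_Ck.
  have [B B0 BP] := bounded_on_ball finite_dim_phase _ (Num.max r (BH + D)) Gc.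
  exists B; split=> // x t xr tD; rewrite derive1n_iterD; apply: BP.
  rewrite prod_normE /= ge_max !le_max xr /=; apply/orP; right.
  rewrite -[t](subrK (Ec 0%N x)) addrC (le_trans (ler_normD _ _))// lerD//.
  exact: BHP.
exists (C1 + \sum_(j < m.+1) B j * D ^+ m.+1).
  by rewrite addr_ge0// sumr_ge0// => j _; rewrite mulr_ge0 ?exprn_ge0//; have [] := BP j.
move=> x h xr h01; have /andP[h0 h1] := h01.
set d := (series_poly m x).[h].
have dD : `|d| <= D * h by have := DP x h xr h01; rewrite expr1.
pose T j := \sum_(p < m.+1) taylor_coef j p x * d ^+ p.
have KE : Kmod K m x h (Etrunc Ec m h x) = (formal_value m x).[h] +
    \sum_(j < m.+1) h ^+ j * (K j x (Ec 0%N x + d) - T j).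
  rewrite /formal_value horner_sum -big_split /= /Kmod Etrunc_series -/d.
  apply: eq_bigr => j _.
  rewrite hornerM hornerXn -mulrDr; congr (_ * _).
  rewrite horner_sum (eq_bigr (fun p : 'I_m.+1 => taylor_coef j p x * d ^+ p)).
    by rewrite [RHS]addrC subrK.
  by move=> p _; rewrite hornerZ horner_exp.
rewrite KE mulrDl (le_trans (ler_normD _ _))// lerD ?C1P//.
rewrite mulr_suml (le_trans (ler_norm_sum _ _ _))// ler_sum// => j _.
have [B0 BPj] := BP j.
rewrite normrM normrX (ger0_norm h0) -[leRHS]mul1r.
apply: ler_pM => //; [exact: exprn_ge0|exact: exprn_ile1|].
have := taylor_bound (K j x) (Ec 0%N x) D (B j) m.+1 (fun k => Ck_fiber j k x)
  (fun t => BPj x t xr) d.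
move=> /(_ (le_trans dD _)) tb; apply: le_trans (tb _) _.
  by rewrite -[leRHS]mulr1 ler_wpM2l.
by rewrite -mulrA -exprMn ler_wpM2l// lerXn2r ?nnegrE// mulr_ge0.
Qed.

End FormalSeries.

(** * Gradient estimate *)

(** Two values of size tau^2 at distance of order tau force a derivative of size 2 A tau somewhere
    between them; moving back to [z] costs at most L |v| tau. *)
Lemma gradient_by_interpolation {R : realType} {V : normedModType R}
    (f : V -> R) (v z : V) (A L tau rho : R) : Ck 1 f ->
  (forall x y, `|x| <= rho -> `|y| <= rho -> `|'D_v f x - 'D_v f y| <= L * `|x - y|) ->
  0 <= L -> 0 < tau <= 1 -> `|z| + `|v| <= rho -> `|f z| <= A * tau ^+ 2 ->
  `|f (z + tau *: v)| <= A * tau ^+ 2 ->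
  `|'D_v f z| <= (2 * A + L * `|v|) * tau.
Proof.
move=> fC fL L0 /andP[tau0 tau1] zv fz fzv.
have [c] := MVT_line f z v tau fC; rewrite (gtr0_norm tau0) => ctau E.
have cv1 : `|c| * `|v| <= tau * `|v| by exact: ler_wpM2r.
have cv2 : tau * `|v| <= `|v| by rewrite ler_piMl.
have zc : `|z + c *: v| <= rho.
  by apply: le_trans (ler_normD _ _) _; rewrite normrZ; lra.
have z0 : `|z| <= rho by apply: le_trans zv; rewrite lerDl.
have := fL _ _ z0 zc; rewrite opprD addNKr normrN normrZ => DD.
have Dc : `|'D_v f (z + c *: v)| <= 2 * A * tau.
  rewrite -(ler_pM2l tau0) -{1}(gtr0_norm tau0) -normrM -E.
  apply: le_trans (ler_normB _ _) _; lra.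
rewrite -['D_v f z](subrK ('D_v f (z + c *: v))).
apply: le_trans (ler_normD _ _) _.
have : L * (`|c| * `|v|) <= L * (tau * `|v|) by exact: ler_wpM2l.
lra.
Qed.

Section TruncatedSystem.
Context {R : realType} {n : nat}.
Local Notation S := 'rV[R]_(n + n).
Variables (K : nat -> S -> R -> R) (Ec : nat -> S -> R).
Hypothesis Ks : forall j, smooth (fun z : S * R => K j z.1 z.2).
Hypothesis EcC : forall k i, Ck k (Ec i).
Hypothesis Ksmall : forall m r, exists2 C, 0 <= C &
  forall x h, `|x| <= r -> 0 <= h <= 1 ->
    `|Kmod K m x h (Etrunc Ec m h x)| <= C * h ^+ m.+1.

(* in both series the terms of order j > l carry s * h^(j - l - 1) in place of
   h^j, so that s = h^(l+1) gives the long truncations and s = 0 the short ones *)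
Definition split_power (l j : nat) (h s : R) : R :=
  if (j <= l)%N then h ^+ j else s * h ^+ (j - l.+1).

Definition split_E (m l : nat) (z : S * R * R) : R :=
  \sum_(i < m.+1) split_power l i z.1.2 z.2 * Ec i z.1.1.

Definition split_K (m l : nat) (z : S * R * R) : R :=
  \sum_(j < m.+1) split_power l j z.1.2 z.2 * K j z.1.1 (split_E m l z).

Lemma split_power_long l j h : split_power l j h (h ^+ l.+1) = h ^+ j.
Proof.
rewrite /split_power; case: leqP => // lj.
by rewrite -exprD subnKC.
Qed.

Lemma split_power_short l j h : (l < j)%N -> split_power l j h 0 = 0.
Proof. by move=> lj; rewrite /split_power leqNgt lj mul0r. Qed.

Lemma split_K_long m l x h : split_K m l (x, h, h ^+ l.+1) =
  Kmod K m x h (Etrunc Ec m h x).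
Proof.
have E : split_E m l (x, h, h ^+ l.+1) = Etrunc Ec m h x.
  by apply: eq_bigr => i _; rewrite split_power_long.
by rewrite /split_K E; apply: eq_bigr => i _; rewrite split_power_long.
Qed.

Lemma split_K_short m l x h : (l <= m)%N -> split_K m l (x, h, 0) =
  Kmod K l x h (Etrunc Ec l h x).
Proof.
move=> lm; have E : split_E m l (x, h, 0) = Etrunc Ec l h x.
  rewrite /split_E (@sum_ord_trim R (fun i => split_power l i h 0 * Ec i x) l.+1)//.
    by apply: eq_bigr => i _; rewrite /split_power -ltnS ltn_ord.
  by move=> i li; rewrite split_power_short// mul0r.
rewrite /split_K E /= (@sum_ord_trim R
  (fun j => split_power l j h 0 * K j x (Etrunc Ec l h x)) l.+1)//.
  by apply: eq_bigr => i _; rewrite /split_power -ltnS ltn_ord.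
by move=> i li; rewrite split_power_short// mul0r.
Qed.

Lemma fst_fst_continuous : continuous (fun z : S * R * R => z.1.1).
Proof.
move=> z; apply: (@cvg_comp _ _ _ (fun z : S * R * R => z.1) fst); exact: cvg_fst.
Qed.

Lemma Ck_split_power k l j : Ck k (fun z : S * R * R => split_power l j z.1.2 z.2).
Proof.
have h k' : Ck k' (fun z : S * R * R => z.1.2).
  apply: Ck_lin => // z.
  by apply: (@cvg_comp _ _ _ (fun z : S * R * R => z.1) snd); [exact: cvg_fst|exact: cvg_snd].
have s : Ck k (fun z : S * R * R => z.2) by apply: Ck_lin => // z; exact: cvg_snd.
rewrite /split_power; case: (j <= l)%N; first exact: Ck_exp.
by apply: Ck_mul => //; exact: Ck_exp.
Qed.

Lemma Ck_split_K k m l : Ck k (split_K m l).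
Proof.
apply: Ck_sum => j _; apply: Ck_mul; first exact: Ck_split_power.
apply: (Ck_comp_pair (S * R * R : Type) S k (fun z : S * R => K j z.1 z.2)
  (fun z => z.1.1) (fun z => z.1.1)) => //; [exact: fst_fst_continuous|exact: smooth_Ck|].
apply: Ck_sum => i _; apply: Ck_mul; first exact: Ck_split_power.
apply: (Ck_comp_aff (S * R * R : Type) S k (Ec i) (fun z => z.1.1) (fun z => z.1.1)) => //.
exact: fst_fst_continuous.
Qed.

Lemma finite_dim_phase2 : finite_dim (S * R * R : Type).
Proof. by apply: finite_dim_prod; [exact: finite_dim_phase|exact: finite_dim_R]. Qed.

(** The long order 2l+1 makes the value estimate h^(2l+2), the square of tau = h^(l+1), as
    interpolation requires. *)
Lemma gradient_small l r (e : S) : exists2 C, 0 <= C & forall x h,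
  `|x| <= r -> 0 < h <= 1 ->
  `|'D_((e, 0), 0) (split_K l.*2.+1 l) (x, h, 0)| <= C * h ^+ l.+1.
Proof.
set G := split_K _ _; set v : S * R * R := (e, 0, 0).
pose rho := Num.max r 1 + `|v|.
have ev : `|e| <= `|v| by rewrite !prod_normE /= !le_max lexx.
have GC k : Ck k G := Ck_split_K k _ _.
have [_ _ /(_ v) DC] := CkS _ _ _ (GC 2%N).
have [L L0 LP] := lipschitz_on_ball finite_dim_phase2 _ rho DC.
have [A A0 AP] := Ksmall l.*2.+1 (r + `|v|).
exists (2 * A + L * `|v| + L); first by rewrite !addr_ge0// mulr_ge0.
move=> x h xr /andP[h0 h1].
have p0 : 0 < h ^+ l.+1 by rewrite exprn_gt0.
have p1 : h ^+ l.+1 <= 1 by rewrite exprn_ile1// ltW.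
have hh : 0 <= h <= 1 by rewrite ltW.
have zr s : 0 <= s <= 1 -> `|(x, h, s) : S * R * R| <= Num.max r 1.
  move=> /andP[s0 s1]; rewrite !prod_normE /= !ge_max !le_max xr /=.
  by rewrite (ger0_norm s0) (gtr0_norm h0) h1 s1 !orbT.
have h2 : (h ^+ l.+1) ^+ 2 = h ^+ l.*2.+2 by rewrite -exprM muln2.
have zrho s : 0 <= s <= 1 -> `|(x, h, s) : S * R * R| <= rho.
  by move=> /zr /le_trans; apply; rewrite lerDl.
have long : `|'D_v G (x, h, h ^+ l.+1)| <= (2 * A + L * `|v|) * h ^+ l.+1.
  apply: (gradient_by_interpolation _ _ _ _ _ _ rho (GC 1%N)) => //.
  - by rewrite p0.
  - by rewrite lerD2r zr// ltW.
  - by rewrite h2 /G split_K_long; apply: AP => //; rewrite (le_trans xr)// lerDl.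
  - have -> : (x, h, h ^+ l.+1) + h ^+ l.+1 *: v = (x + h ^+ l.+1 *: e, h, h ^+ l.+1).
      by rewrite /v !pair_line !mulr0 !addr0.
    rewrite h2 /G split_K_long; apply: AP => //.
    apply: le_trans (ler_normD _ _) _; apply: lerD => //.
    by rewrite normrZ gtr0_norm// (le_trans _ ev)// ler_piMl.
(* Passing from s = h^(l+1) to s = 0 displaces the point by h^(l+1), so the Lipschitz derivative
   changes by at most L h^(l+1). *)
rewrite mulrDl -['D_v G _](subrK ('D_v G (x, h, h ^+ l.+1))) addrC.
apply: le_trans (ler_normD _ _) _; apply: lerD => //.
have := LP (x, h, 0) (x, h, h ^+ l.+1).
rewrite !zrho ?lexx ?ler01//; last by rewrite ltW.
move=> /(_ isT isT) /le_trans; apply; apply: ler_wpM2l => //.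
have -> : (x, h, 0) - (x, h, h ^+ l.+1) = (0, 0, - h ^+ l.+1) :> S * R * R.
  by rewrite -[LHS]/(x - x, h - h, 0 - h ^+ l.+1) !subrr sub0r.
by rewrite !prod_normE /= !normr0 normrN (gtr0_norm p0) maxxx max_r ?lexx ?(ltW p0).
Qed.

End TruncatedSystem.

(** * The truncated vector fields *)

Lemma phase_norm_le {R : realType} {n : nat} (u : 'rV[R]_(n + n)) (B : R) : 0 <= B ->
  (forall i, `|u 0 (lshift n i)| <= B) -> (forall i, `|u 0 (rshift n i)| <= B) ->
  `|u| <= B.
Proof.
move=> B0 ul ur; apply: mx_norm_le => // i j; rewrite (ord1 i).
by case: (split_ordP j) => k ->.
Qed.

Section VectorFields.
Context {R : realType} {n : nat}.
Local Notation S := 'rV[R]_(n + n).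
Variables (K : nat -> S -> R -> R) (Ec : nat -> S -> R).
Hypothesis Ks : forall j, smooth (fun z : S * R => K j z.1 z.2).
Hypothesis EcC : forall k i, Ck k (Ec i).
Hypothesis Ksmall : forall m r, exists2 C, 0 <= C &
  forall x h, `|x| <= r -> 0 <= h <= 1 ->
    `|Kmod K m x h (Etrunc Ec m h x)| <= C * h ^+ m.+1.

Lemma Ck_Etrunc k l h : Ck k (Etrunc Ec l h).
Proof.
by apply: Ck_sum => i _; apply: Ck_mul => //; exact: Ck_cst.
Qed.

Lemma Ck_Etrunc_joint k l : Ck k (fun z : S * R => Etrunc Ec l z.2 z.1).
Proof.
apply: Ck_sum => i _; apply: Ck_mul.
  by apply/Ck_exp/Ck_lin => // z; exact: cvg_snd.
apply: (Ck_comp_aff (S * R : Type) S k (Ec i) fst fst) => // z; exact: cvg_fst.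
Qed.

Lemma Ck_Kmod k l h : Ck k (fun z : S * R => Kmod K l z.1 h z.2).
Proof.
by apply: Ck_sum => i _; apply: Ck_mul; [exact: Ck_cst|exact: smooth_Ck].
Qed.

Lemma Ck_Kmod_joint k l : Ck k (fun z : S * R * R => Kmod K l z.1.1 z.1.2 z.2).
Proof.
apply: Ck_sum => j _; apply: Ck_mul.
  apply/Ck_exp/Ck_lin => // z.
  by apply: (@cvg_comp _ _ _ (fun z : S * R * R => z.1) snd); [exact: cvg_fst|exact: cvg_snd].
apply: (Ck_comp_pair (S * R * R : Type) S k (fun z : S * R => K j z.1 z.2)
  (fun z => z.1.1) (fun z => z.1.1)) => //; [exact: fst_fst_continuous|exact: smooth_Ck|].
by apply: Ck_lin => // z; exact: cvg_snd.
Qed.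

(** With h and E as further variables, one compact ball gives bounds uniform in both. *)
Lemma derive_Kmod_x l h E (e x : S) :
  'D_e (fun y => Kmod K l y h E) x =
  'D_((e, 0), 0) (fun z : S * R * R => Kmod K l z.1.1 z.1.2 z.2) (x, h, E).
Proof.
have [_ Kd _] := CkS _ _ _ (Ck_Kmod_joint 1 l).
have := is_derive_comp_aff S (S * R * R : Type)
  (fun z : S * R * R => Kmod K l z.1.1 z.1.2 z.2)
  (fun y => (y, h, E)) (fun v => (v, 0, 0)) x e.
by case=> [s y z|//|_ <-] //; rewrite !pair_line !mulr0 !addr0.
Qed.

Lemma dKdE_joint l h x : dKdE K Ec l h x =
  'D_(0, 1) (fun z : S * R * R => Kmod K l z.1.1 z.1.2 z.2) (x, h, Etrunc Ec l h x).
Proof.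
have [_ Kd _] := CkS _ _ _ (Ck_Kmod_joint 1 l).
have := is_derive_comp_aff R (S * R * R : Type)
  (fun z : S * R * R => Kmod K l z.1.1 z.1.2 z.2)
  (fun E => (x, h, E)) (fun v => (0, v)) (Etrunc Ec l h x) 1.
case=> [s y z|//|_ <-] //; last by rewrite /dKdE derive1E.
by rewrite pair_line scaler0 addr0.
Qed.

(** Chain rule on the slice s = 0: the first term belongs to the Hamiltonian field at frozen energy,
    the second to the truncated field. *)
Lemma derive_split_short m l h (e x : S) : (l <= m)%N ->
  'D_((e, 0), 0) (split_K K Ec m l) (x, h, 0) =
  'D_e (fun y => Kmod K l y h (Etrunc Ec l h x)) x
    + dKdE K Ec l h x * 'D_e (Etrunc Ec l h) x.
Proof.
move=> lm.
have [_ Gd _] := CkS _ _ _ (Ck_split_K K Ec Ks EcC 1 m l).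
have := is_derive_comp_aff S (S * R * R : Type) (split_K K Ec m l)
  (fun y => (y, h, 0)) (fun v => (v, 0, 0)) x e.
case=> [s y z|//|_ <-]; first by rewrite !pair_line !mulr0 !addr0.
rewrite (_ : (fun y => _) = fun y => Kmod K l y h (Etrunc Ec l h y)); last first.
  by apply/funext => y; exact: split_K_short.
have [Ec_c Ec_d _] := CkS _ _ _ (Ck_Etrunc 1 l h).
have [_ Fd _] := CkS _ _ _ (Ck_Kmod 1 l h).
have := is_derive_comp_pair S S (fun z : S * R => Kmod K l z.1 h z.2) id id
  (Etrunc Ec l h) x e (fun _ _ _ => erefl) (Ck_Kmod 1 l h) Ec_c (Ec_d x e).
case=> _ ->.
congr (_ + _ * _).
  have := is_derive_comp_aff S (S * R : Type) (fun z : S * R => Kmod K l z.1 h z.2)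
    (fun y => (y, Etrunc Ec l h x)) (fun v => (v, 0)) x e.
  by case=> [s y z|//|_ <-] //; rewrite pair_line mulr0 addr0.
have := is_derive_comp_aff R (S * R : Type) (fun z : S * R => Kmod K l z.1 h z.2)
    (fun E => (x, E)) (fun v => (0, v)) (Etrunc Ec l h x) 1.
case=> [s y z|//|_ <-] //; last by rewrite /dKdE derive1E.
by rewrite pair_line scaler0 addr0.
Qed.

(* up to sign, the entries of the difference are the partial derivatives of
   x |-> Kmod K l x h (Etrunc Ec l h x) *)
Lemma mod_vf_defect l r : exists2 C, 0 <= C & forall x h,
  `|x| <= r -> 0 < h <= 1 ->
  `|mod_vf K Ec l h x - ham_vf (fun y => Kmod K l y h (Etrunc Ec l h x)) x|
    <= C * h ^+ l.+1.
Proof.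
have /choice[C CP] : forall e : S, exists C, 0 <= C /\ forall x h,
    `|x| <= r -> 0 < h <= 1 ->
    `|'D_((e, 0), 0) (split_K K Ec l.*2.+1 l) (x, h, 0)| <= C * h ^+ l.+1.
  by move=> e; have [C] := gradient_small K Ec Ks EcC Ksmall l r e; exists C.
have C0 e : 0 <= C e by have [] := CP e.
pose B := \sum_(i < n) (C (ep_dir R i) + C (eq_dir R i)).
have B0 : 0 <= B by apply: sumr_ge0 => i _; rewrite addr_ge0.
have CB i : C (ep_dir R i) <= B /\ C (eq_dir R i) <= B.
  rewrite /B (bigD1 i)//=; set s := \sum_(_ < n | _) _.
  have : 0 <= s by apply: sumr_ge0 => j _; rewrite addr_ge0.
  have := C0 (ep_dir R i); have := C0 (eq_dir R i); lra.
exists B => // x h xr h01; have h0 : 0 <= h ^+ l.+1.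
  by rewrite exprn_ge0//; case/andP: h01 => /ltW.
have ll : (l <= l.*2.+1)%N by lia.
apply: phase_norm_le => [|i|i]; first exact: mulr_ge0.
- have [_ /(_ x h xr h01)] := CP (ep_dir R i).
  rewrite derive_split_short// => le; apply: le_trans (ler_wpM2r h0 (CB i).1).
  apply: le_trans le; rewrite /mod_vf /ham_vf /cham_vf mxE [X in _ + X]mxE.
  by rewrite !row_mxEl !mxE mul1r -opprD normrN addrC.
- have [_ /(_ x h xr h01)] := CP (eq_dir R i).
  rewrite derive_split_short// => le; apply: le_trans (ler_wpM2r h0 (CB i).2).
  apply: le_trans le; rewrite /mod_vf /ham_vf /cham_vf mxE [X in _ + X]mxE.
  by rewrite !row_mxEr !mxE mul1r opprK addrC.
Qed.

(** The constants must not depend on h and E, because the energy is later frozen at a value that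
    varies with h and the initial point. *)
Lemma ham_vf_bounds l (r : R) : exists M L, [/\ 0 <= M, 0 <= L,
  forall x h E, `|x| <= r -> `|E| <= r -> 0 <= h <= 1 ->
    `|ham_vf (fun y => Kmod K l y h E) x| <= M &
  forall x y h E, `|x| <= r -> `|y| <= r -> `|E| <= r -> 0 <= h <= 1 ->
    `|ham_vf (fun y => Kmod K l y h E) x - ham_vf (fun y => Kmod K l y h E) y|
      <= L * `|x - y|].
Proof.
pose D (e : S) := 'D_((e, 0), 0) (fun z : S * R * R => Kmod K l z.1.1 z.1.2 z.2).
have DC e : Ck 1 (D e).
  by have [_ _] := CkS _ _ _ (Ck_Kmod_joint 2 l); apply.
pose rho := Num.max r 1.
have /choice[M MP] : forall e, exists M, 0 <= M /\ forall z, `|z| <= rho -> `|D e z| <= M.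
  move=> e; have [M] := bounded_on_ball finite_dim_phase2 _ rho (Ck_continuous _ _ (DC e)).
  by exists M.
have /choice[L LP] : forall e, exists L, 0 <= L /\ forall z w, `|z| <= rho -> `|w| <= rho ->
    `|D e z - D e w| <= L * `|z - w|.
  by move=> e; have [L] := lipschitz_on_ball finite_dim_phase2 _ rho (DC e); exists L.
have sums (C : S -> R) : (forall e, 0 <= C e) -> exists2 B, 0 <= B &
    forall i, C (ep_dir R i) <= B /\ C (eq_dir R i) <= B.
  move=> C0; exists (\sum_(i < n) (C (ep_dir R i) + C (eq_dir R i))).
    by apply: sumr_ge0 => i _; rewrite addr_ge0.
  move=> i; rewrite (bigD1 i)//=; set s := \sum_(_ < n | _) _.
  have : 0 <= s by apply: sumr_ge0 => j _; rewrite addr_ge0.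
  have := C0 (ep_dir R i); have := C0 (eq_dir R i); lra.
have [BM BM0 BMP] := sums M (fun e => (MP e).1).
have [BL BL0 BLP] := sums L (fun e => (LP e).1).
have zr (x : S) (h E : R) : `|x| <= r -> `|E| <= r -> 0 <= h <= 1 ->
    `|(x, h, E) : S * R * R| <= rho.
  move=> xr Er /andP[h0 h1]; rewrite !prod_normE /= !ge_max !le_max xr Er /=.
  by rewrite ger0_norm// h1 orbT.
have diff (x y : S) (h E : R) : `|(x, h, E) - (y, h, E)| = `|x - y| :> R.
  rewrite -[X in `|X| = _]/(x - y, h - h, E - E) !subrr !prod_normE /= !normr0.
  by rewrite !max_l.
exists BM, BL; split=> // [x h E xr Er h01|x y h E xr yr Er h01].
  apply: phase_norm_le => // i; rewrite /ham_vf /cham_vf ?row_mxEl ?row_mxEr mxE mul1r.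
    by rewrite derive_Kmod_x (le_trans _ (BMP i).1)//; apply: (MP _).2; exact: zr.
  by rewrite normrN derive_Kmod_x (le_trans _ (BMP i).2)//; apply: (MP _).2; exact: zr.
apply: phase_norm_le => [|i|i]; first exact: mulr_ge0.
  rewrite /ham_vf /cham_vf mxE [X in _ + X]mxE !row_mxEl !mxE !mul1r !derive_Kmod_x.
  apply: le_trans (ler_wpM2r _ (BLP i).1) => //; rewrite -(diff x y h E).
  by apply: (LP _).2; exact: zr.
rewrite /ham_vf /cham_vf mxE [X in _ + X]mxE !row_mxEr !mxE !mul1r !derive_Kmod_x.
rewrite -opprD normrN.
apply: le_trans (ler_wpM2r _ (BLP i).2) => //; rewrite -(diff x y h E).
by apply: (LP _).2; exact: zr.
Qed.

Lemma Etrunc_bound l r : exists2 B, 0 <= B & forall x h, `|x| <= r -> 0 <= h <= 1 ->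
  `|Etrunc Ec l h x| <= B.
Proof.
have [B B0 BP] := bounded_on_ball finite_dim_phase _ (Num.max r 1)
  (Ck_continuous _ _ (Ck_Etrunc_joint 0 l)).
exists B => // x h xr /andP[h0 h1]; apply: (BP (x, h)).
by rewrite prod_normE /= ge_max !le_max xr ger0_norm// h1 orbT.
Qed.

Lemma Etrunc_conserved l h x a b s t :
  solution_on (mod_vf K Ec l h) x a b -> a < s -> s <= t -> t < b ->
  Etrunc Ec l h (x t) = Etrunc Ec l h (x s).
Proof.
move=> xsol as_ st tb.
have dE u : a < u < b -> is_derive u 1 (fun u => Etrunc Ec l h (x u)) 0.
  move=> /xsol[xd xD].
  have := is_derive_along (finite_dim_rV _) _ x u (Ck_Etrunc 1 l h) xd.
  congr (is_derive _ _ _ _); rewrite xD.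
  (* Expanding the field in coordinates, the q and p contributions cancel in pairs. *)
  rewrite [X in 'D_X _ _]row_sum_delta derive_dir_sum; last exact: Ck_Etrunc.
  rewrite big_split_ord /= -big_split big1// => i _ /=.
  rewrite /mod_vf row_mxEl row_mxEr !mxE /eq_dir /ep_dir; ring.
have [||c _ /eqP] := @MVT_segment R (fun u => Etrunc Ec l h (x u)) (fun=> 0) s t st.
- move=> u; rewrite in_itv /= => /andP[su ut].
  by apply: dE; rewrite (lt_trans as_)// (lt_trans ut).
- apply: derivable_within_continuous => u; rewrite in_itv /= => /andP[su ut].
  by have [] := dE u _; rewrite // (lt_le_trans as_)// (le_lt_trans ut).
- by rewrite mul0r subr_eq0 => /eqP.
Qed.

(** On the ball 1/N <= B, so N > 1/(B+1); the factor is Lipschitz in h, and the choice of [h0] keeps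
    its change L h below this gap. *)
Lemma Nmod_pos (N : S -> R) l r : (forall x, 0 < N x) -> continuous N ->
  (forall x, Nmod K Ec l 0 x = N x) ->
  exists2 h0, 0 < h0 & forall x h, `|x| <= r -> 0 < h < h0 -> 0 < Nmod K Ec l h x.
Proof.
move=> N0 Nc NE.
have [B B0 BP] : exists2 B, 0 <= B & forall x, `|x| <= r -> `|(N x)^-1| <= B.
  have Ninv : Ck 0 (fun x => (N x)^-1).
    by apply: Ck_inv => // x; exact: lt0r_neq0.
  exact: (bounded_on_ball (finite_dim_rV _) _ r Ninv).
pose D := 'D_(0, 1) (fun z : S * R * R => Kmod K l z.1.1 z.1.2 z.2).
have wC : Ck 1 (fun z : S * R => D (z, Etrunc Ec l z.2 z.1)).
  apply: (Ck_comp_pair (S * R : Type) (S * R : Type) 1 D id id) => //.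
  - by move=> z; exact: cvg_id.
  - by have [_ _] := CkS _ _ _ (Ck_Kmod_joint 2 l); apply.
  - exact: Ck_Etrunc_joint.
have [L L0 LP] := lipschitz_on_ball finite_dim_phase _ (Num.max r 1) wC.
have BL0 : 0 < (B + 1) * (L + 1) by rewrite mulr_gt0// ltr_wpDl.
exists (Num.min 1 ((B + 1) * (L + 1))^-1); first by rewrite lt_min ltr01 invr_gt0.
move=> x h xr /andP[h0]; rewrite lt_min => /andP[h1 hBL].
have zr (s : R) : 0 <= s <= 1 -> `|(x, s) : S * R| <= Num.max r 1.
  by move=> /andP[s0 s1]; rewrite prod_normE /= ge_max !le_max xr ger0_norm// s1 orbT.
have h01 : 0 <= h <= 1 by rewrite !ltW.
have z01 : 0 <= 0 :> R /\ 0 <= 1 :> R by rewrite lexx ler01.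
have := LP (x, h) (x, 0) (zr _ h01) (zr _ (introT andP z01)) => /=.
rewrite /D /= -!dKdE_joint. rewrite -[X in `|X|]opprK normrN opprD opprK.
rewrite -[- dKdE _ _ _ h _]/(Nmod K Ec l h x) -[dKdE _ _ _ 0 _]opprK.
rewrite -[- dKdE _ _ _ 0 _]/(Nmod K Ec l 0 x) NE.
have -> : `|(x, h) - (x, 0) : S * R| = h.
  by rewrite -[X in `|X|]/(x - x, h - 0) subrr subr0 prod_normE /= normr0 max_r ?ger0_norm ?ltW.
rewrite ler_norml => /andP[+ _].
have N1 : (B + 1)^-1 < N x.
  have B1 : 0 < B + 1 by rewrite ltr_wpDl.
  rewrite invf_plt ?posrE//.
  by have := BP x xr; rewrite gtr0_norm ?invr_gt0//; lra.
have : L * h < (B + 1)^-1.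
  apply: (@le_lt_trans _ _ ((L + 1) * h)); first by rewrite ler_wpM2r ?lerDl// ltW.
  have L1 : 0 < L + 1 by rewrite ltr_wpDl.
  by move: hBL; rewrite invfM ltr_pdivlMr// mulrC.
lra.
Qed.

End VectorFields.

(** * The main estimate *)

(** Clamping each coordinate to [-rho, rho] is a 1-Lipschitz retraction onto the ball of the maximum
    norm. The extension meets the global hypotheses of [ode_exists]. *)
Lemma lipschitz_extension {R : realType} {m : nat} (X : 'rV[R]_m -> 'rV[R]_m)
    (rho M L : R) : 0 <= rho -> 0 <= L ->
  (forall v, `|v| <= rho -> `|X v| <= M) ->
  (forall u v, `|u| <= rho -> `|v| <= rho -> `|X u - X v| <= L * `|u - v|) ->
  exists F : 'rV[R]_m -> 'rV[R]_m, [/\ forall v, `|v| <= rho -> F v = X v,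
    forall v, `|F v| <= M & forall u v, `|F u - F v| <= L * `|u - v|].
Proof.
move=> rho0 L0 XM XL.
pose c (t : R) := Num.max (- rho) (Num.min rho t).
pose clamp (v : 'rV[R]_m) : 'rV[R]_m := \row_i c (v 0 i).
have crho t : `|c t| <= rho.
  by rewrite ler_norml /c le_max lexx ge_max ge_min lexx !andbT /=; lra.
have cid t : `|t| <= rho -> c t = t.
  by rewrite ler_norml => /andP[t1 t2]; rewrite /c min_r// max_r.
have clip s t : `|c s - c t| <= `|s - t|.
  have minl (u v : R) : `|Num.min rho u - Num.min rho v| <= `|u - v|.
    have := ler_norm (v - u); have := ler_norm (u - v); rewrite (distrC v u) ler_norml.
    by case: (leP rho u) => ?; case: (leP rho v) => ? ? ?; apply/andP; split; lra.
  apply: le_trans (minl s t); rewrite /c; set u := Num.min _ s; set v := Num.min _ t.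
  have := ler_norm (v - u); have := ler_norm (u - v); rewrite (distrC v u) ler_norml.
  by case: (leP (- rho) u) => ?; case: (leP (- rho) v) => ? ? ?; apply/andP; split; lra.
have Crho v : `|clamp v| <= rho by apply: mx_norm_le => // i j; rewrite mxE.
exists (fun v => X (clamp v)); split=> [v vr|v|u v].
- congr X; apply/rowP => i; rewrite mxE cid//.
  exact: le_trans (mx_entry_le _ _ _ _ _) vr.
- exact: XM.
- apply: le_trans (XL _ _ (Crho u) (Crho v)) _; apply: ler_wpM2l => //.
  apply: mx_norm_le => // i j; rewrite (ord1 i) !mxE; apply: le_trans (clip _ _) _.
  by have := mx_entry_le _ _ (u - v) 0 j; rewrite !mxE.
Qed.

Section Main.
Context {R : realType} {n : nat}.
Local Notation S := 'rV[R]_(n + n).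
Variables (K : nat -> S -> R -> R) (Ec : nat -> S -> R) (Psi : R -> R -> S -> S).
Hypothesis Ks : forall j, smooth (fun z : S * R => K j z.1 z.2).
Hypothesis EcC : forall k i, Ck k (Ec i).
Hypothesis Ksmall : forall m r, exists2 C, 0 <= C &
  forall x h, `|x| <= r -> 0 <= h <= 1 ->
    `|Kmod K m x h (Etrunc Ec m h x)| <= C * h ^+ m.+1.
Hypothesis PsiK : is_modified_hamiltonian Psi K.

Lemma Phi_approximates_flow (l : nat) (r : R) : 0 < r -> exists C h0, 0 < h0 /\
  forall h, 0 < h < h0 -> forall (x : R -> S) a b t,
    solution_on (mod_vf K Ec l h) x a b ->
    a < t -> t + h < b -> `|x t| <= r ->
    `|Phi Psi Ec l h (x t) - x (t + h)| <= C * h ^+ l.+2.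
Proof.
move=> r0.
have [D D0 DP] := mod_vf_defect K Ec Ks EcC Ksmall l (r + 1).
have [B B0 BP] := Etrunc_bound Ec EcC l r.
(* One radius for both the positions, up to r + 1, and the energy. *)
pose rho := Num.max (r + 1) B.
have rho0 : 0 < rho by rewrite lt_max addr_gt0.
have r1rho : r + 1 <= rho by rewrite le_max lexx.
have [M [L [M0 L0 MP LP]]] := ham_vf_bounds K Ks l rho.
have [C [hP [hP0 PsiP]]] := PsiK l rho rho0.
(* The condition h c < 1 gives h (M + D) < 1 to confine [x], h L <= 1/2 for the comparison, and 2 h
   M <= 1 to confine the comparison solution. *)
pose c := 2 * (M + D + L + 1).
have c0 : 0 < c by rewrite mulr_gt0// ltr_wpDl// !addr_ge0.
exists (C + 2 * D), (Num.min hP (Num.min 1 c^-1)).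
split; first by rewrite !lt_min hP0 ltr01 invr_gt0.
move=> h /andP[h0]; rewrite !lt_min => /and3P[hhP h1 hc] x a b t xsol at_ tb xtr.
have hc1 : h * c < 1 by rewrite -ltr_pdivlMr// div1r.
have hM : 0 <= h * M by rewrite mulr_ge0// ltW.
have hD : 0 <= h * D by rewrite mulr_ge0// ltW.
have hL : 0 <= h * L by rewrite mulr_ge0// ltW.
have hcE : h * c = 2 * (h * M) + 2 * (h * D) + 2 * (h * L) + 2 * h by rewrite /c; ring.
have hh : 0 < h <= 1 by rewrite h0 ltW.
have hh' : 0 <= h <= 1 by rewrite !ltW.
set E := Etrunc Ec l h (x t).
have Erho : `|E| <= rho by rewrite le_max BP ?orbT.
pose X := ham_vf (fun y => Kmod K l y h E).
have [F [FX FM FL]] := lipschitz_extension X rho M L (ltW rho0) L0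
  (fun v vr => MP v h E vr Erho hh') (fun u v ur vr => LP u v h E ur vr Erho hh').
have inab s : t <= s <= t + h -> a < s < b.
  by move=> /andP[ts sth]; rewrite (lt_le_trans at_)// (le_lt_trans sth).
have xE s : t <= s <= t + h -> Etrunc Ec l h (x s) = E.
  move=> /andP[ts sth].
  exact: (Etrunc_conserved K Ec EcC l h x a b t s xsol at_ ts (le_lt_trans sth tb)).
have xdef s : t <= s <= t + h -> `|x s| <= r + 1 ->
    `|'D_1 x s - X (x s)| <= D * h ^+ l.+1.
  move=> sth xr; have [_ ->] := xsol _ (inab _ sth).
  by have := DP (x s) h xr hh; rewrite xE.
have hl1 : h ^+ l.+1 <= 1 by rewrite exprn_ile1// ltW.
have xball : forall s, t <= s <= t + h -> `|x s| <= r + 1.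
  apply: (stays_in_ball x r (M + D) t h) => //; [exact: addr_ge0|exact: ltW|lra| |].
    by move=> s /inab /xsol[].
  move=> s sth xr; rewrite -['D_1 x s](subrK (X (x s))) addrC.
  apply: le_trans (ler_normD _ _) _; apply: lerD.
    by apply: MP => //; exact: le_trans xr r1rho.
  by apply: le_trans (xdef s sth xr) _; rewrite ler_piMr.
have [y [y0 yd yM]] := ode_exists F M L (x t) (finite_dim_rV _) L0 FM FL.
pose z s := y (s - t).
have zd (s : R) : is_derive s 1 z (F (z s)).
  have /is_deriveP := yd (s - t); move=> yd'; apply/is_deriveP; apply: cvg_ext yd' => d.
  by rewrite /z addrAC.
have zt : z t = x t by rewrite /z subrr y0.
(* The interval strictly contains [t, t + h], as the modified Hamiltonian property demands; on it
   [z] stays where the extension agrees with [X]. *)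
have zsol : solution_on X z (t - h) (t + 2 * h).
  move=> s /andP[s1 s2]; have [zds ->] := zd s; split=> //; apply: FX.
  apply: le_trans r1rho; rewrite -[z s](subrK (x t)) addrC.
  apply: le_trans (ler_normD _ _) _; apply: lerD => //.
  apply: le_trans (yM _) _.
  have sh : `|s - t| <= 2 * h by rewrite ler_norml; apply/andP; split; lra.
  have := ler_wpM2l M0 sh; lra.
have psi : `|Psi h E (z t) - z (t + h)| <= C * h ^+ l.+2.
  apply: (PsiP h E _ Erho z (t - h) (t + 2 * h) t) => //.
  - by rewrite h0.
  - lra.
  - lra.
  - by rewrite zt (le_trans xtr)// (le_trans _ r1rho)// lerDl.
have cmp : `|x (t + h) - z (t + h)| <= 2 * h * (D * h ^+ l.+1).
  apply: (compare_with_solution F x z L _ t h FL) => //.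
  - by rewrite mulr_ge0// exprn_ge0// ltW.
  - exact: ltW.
  - lra.
  - by move=> s /inab /xsol[].
  - move=> s sth; rewrite FX; first exact: xdef (xball _ sth).
    exact: le_trans (xball _ sth) r1rho.
rewrite /Phi -/E -zt.
have -> : Psi h E (z t) - x (t + h) =
    (Psi h E (z t) - z (t + h)) - (x (t + h) - z (t + h)).
  by rewrite opprB addrA subrK.
apply: le_trans (ler_normB _ _) _.
apply: le_trans (lerD psi cmp) _.
by rewrite le_eqVlt; apply/orP; left; apply/eqP; rewrite [in RHS]exprS exprS; ring.
Qed.

End Main.

Theorem theorem4p2 (R : realType) (n : nat)
  (H N : 'rV[R]_(n + n) -> R)
  (Psi : R -> R -> 'rV[R]_(n + n) -> 'rV[R]_(n + n))
  (K : nat -> 'rV[R]_(n + n) -> R -> R)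
  (Ec : nat -> 'rV[R]_(n + n) -> R)
  (l : nat) :
  smooth H -> smooth N -> (forall x, 0 < N x) ->
  (* K_0 = K_E = N (H - E) *)
  (forall x E, K 0%N x E = N x * (H x - E)) ->
  (forall j, smooth (fun z : 'rV[R]_(n + n) * R => K j z.1 z.2)) ->
  symplectic_integrator Psi ->
  is_modified_hamiltonian Psi K ->
  (* E(x;h) = H + h E_1 + ... defined by K_mod(x; h, E(x;h)) = 0 formally *)
  Ec 0%N = H ->
  (forall k x, comp_coeff K Ec k x = 0) ->
  (forall r, 0 < r -> exists C h0, 0 < h0 /\
     forall h, 0 < h < h0 ->
     forall (x : R -> 'rV[R]_(n + n)) a b t,
       solution_on (mod_vf K Ec l h) x a b ->
       a < t -> t + h < b -> `|x t| <= r ->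
       `|Phi Psi Ec l h (x t) - x (t + h)| <= C * h ^+ l.+2)
  /\
  (forall r, 0 < r -> exists h0, 0 < h0 /\
     forall h, 0 < h < h0 ->
       conf_ham_on [set y | `|y| <= r] (mod_vf K Ec l h)
                   (Etrunc Ec l h) (Nmod K Ec l h)).
Proof.
move=> Hs Ns N0 K0E Ks _ PsiK EcH comp0.
have EcC := Ec_Ck H N K Ec Hs Ns N0 K0E Ks EcH comp0.
have Ksmall := Kmod_Etrunc_small H N K Ec Hs Ns N0 K0E Ks EcH comp0.
split=> r r0; first exact: Phi_approximates_flow.
(* At h = 0 only K_0 remains, and its derivative in E is -N. *)
have NE x : Nmod K Ec l 0 x = N x.
  rewrite /Nmod /dKdE (_ : (fun E => Kmod K l x 0 E) = K 0%N x).
    by rewrite (derive1_K0 H N K K0E) opprK.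
  apply/funext => E; rewrite /Kmod big_ord_recl expr0 mul1r big1 ?addr0// => i _.
  by rewrite exprS mul0r mul0r.
have Nc : continuous N by exact: (smooth_Ck _ N Ns 0).
have [h0 h00 Npos] := Nmod_pos K Ec Ks EcC N l r N0 Nc NE.
exists h0; split=> // h hh x xr; split; first exact: Npos.
rewrite /mod_vf /cham_vf /Nmod; congr (row_mx _ _); apply/rowP => i; rewrite !mxE.
  by rewrite mulNr.
by rewrite mulNr opprK.
Qed.
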